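(* Let $\Psi^*_t$ be a dynamical system from $\bar D^*\times C([0,t],D)$ to $\bar D^*$. Assume that (a) for any $x^*\in\bar D^*$, $X\in C(\mathbb{R}_+,D)$ and $t>0$, $\Gamma(x^*,X(0))=\Gamma(\Psi^*_t(x^*,X),X(t))$ holds; (b) for each $t>0$, $Q_tf(x^* )=\mathbf{E}_{\mathbb{P}_x}[f(\Psi^*_t(x^*,X(t-\cdot)))]$, $x^*\in\bar D^*$, defines a Markov semigroup on $\bar D^*$ uniquely regardless of the initial state $X(0)=x$; and (c) $(\Psi^*_t(x^*,X),X(t))$ is Markovian whenever $X(t)$ is Markovian. Then the semigroup $$V_tg(x^*,x)=\mathbf{E}_{\mathbb{P}_x}[g(\Psi^*_t(x^*,X),X(t))],\qquad (x^*,x)\in E,$$ is $\Lambda$-linked between $P_t$ and $Q^*_t$, where $Q^*_tf(x^* )=\frac{1}{h(x^* )}Q_t[hf](x^* )$ for $x^*\in D^*$ and the link is $\lambda(x^*,x)=\frac{\Gamma(x^*,x)}{h(x^* )}\nu(x)$.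
   Context: Let $D=\mathbb{R}^n$, let $\gamma:\mathbb{R}^n\to\mathbb{R}$, $\nu=\exp(-2\gamma)$, $\beta=\nabla\gamma$ (assumed smooth enough), and let $P_t$ be the semigroup on $D$ of the characteristic diffusion for $\nu$, $dX(t)=-\beta(X(t))dt+dW(t)$. $\mathbb{P}_x$ is its law on $C(\mathbb{R}_+,D)$ started at $X(0)=x$; its transition density $p$ is $\nu$-symmetric: $\nu(x)p(t,x,y)=\nu(y)p(t,y,x)$. $D^*$ is a Polish space, open relative to an extension $\bar D^*=D^*\cup\partial$ which is also Polish. $\Gamma$ is a bounded nonnegative measurable function on $D^*\times D$, extended by $\Gamma(x^*,x)=0$ for $x^*\in\partial$. It is assumed that $E=\{(x^*,x)\in D^*\times D:\Gamma(x^*,x)>0\}$ is Polish and that $h(x^* )=\int\Gamma(x^*,x)\nu(x)\,dx$ is finite and strictly positive on $D^*$ ($h=0$ on $\partial$). A dynamical system $\Psi^*_t$ is a family $(\Psi^*_t)_{t\ge0}$ of measurable maps from $\bar D^*\times C([0,t],\mathbb{R}^n)$ to $\bar D^*$ such that, for each $(x^*,\omega)\in D^*\times C(\mathbb{R}_+,\mathbb{R}^n)$, $\Psi^*_0(x^*,\omega)=x^*$ and $\Psi^*_t(x^*,\omega)$ is continuous in $t\in[0,\zeta(x^*,\omega))$, where $\zeta(x^*,\omega)=\inf\{t\ge0:\Psi^*_t(x^*,\omega)\in\partial\}$; a path on $\mathbb{R}_+$ is inserted via its restriction to $[0,t]$. $X(t-\cdot)$ denotes the path $u\mapsto X(t-u)$,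 $0\le u\le t$. A Markov semigroup $V_t$ on $E$ is $\Lambda$-linked between $P_t$ and $Q^*_t$ (with link $\lambda$) if (i) $V_tf=P_tf$ whenever $f(x^*,x)=f(x)$ on $E$; and (ii) $\int\lambda(x^*,x)V_tg(x^*,x)\,dx=\int Q^*_t(x^*,dy^* )\int\lambda(y^*,y)g(y^*,y)\,dy$ for any $x^*\in D^*$ and any bounded measurable $g$ on $E$. *)

(* Defs.v *)
From HB Require Import structures.
From mathcomp Require Import all_boot all_order all_algebra.
From mathcomp Require Import all_classical all_reals all_analysis.

Set Implicit Arguments.
Unset Strict Implicit.
Unset Printing Implicit Defensive.

Import Order.TTheory GRing.Theory Num.Theory.
Import numFieldNormedType.Exports.

Local Open Scope classical_set_scope.
Local Open Scope ring_scope.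

(* [A], with the topology induced by [T], is a Polish space.  The values of
   the metric outside of [A] are irrelevant. *)
Definition polish (R : realType) (T : topologicalType) (A : set T) : Prop :=
  exists d : T -> T -> R,
    (forall x y, A x -> A y ->
       [/\ 0 <= d x y, d x y = 0 <-> x = y & d x y = d y x])
    /\ (forall x y z, A x -> A y -> A z -> d x z <= d x y + d y z)
    /\ (forall x, A x -> forall U : set T,
          within A (nbhs x) U <->
          exists2 e : R, 0 < e & forall y, A y -> d x y < e -> U y)
    /\ (forall u : nat -> T, (forall k, A (u k)) ->
          (forall e : R, 0 < e -> exists N, forall k l,
             (N <= k)%N -> (N <= l)%N -> d (u k) (u l) < e) ->
          exists2 l, A l & d l (u k) @[k --> \oo] --> (0 : R))
    /\ (exists C : set T, [/\ countable C, C `<=` A &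
          forall x, A x -> forall e : R, 0 < e -> exists2 c, C c & d x c < e]).

Notation borel T := (g_sigma_algebraType (@open T)).

Definition rV_display : measure_display. Proof. exact: default_measure_display. Qed.

(* The product sigma-algebra, as for the library's [n.-tuple]; it is the Borel
   sigma-algebra of [R^n]. *)
Section measurable_rV.
Context {R : realType} {n : nat}.

Let coors : 'I_n -> 'rV[R]_n -> R := fun i x => x ord0 i.

Let rV_set0 : g_sigma_preimage coors set0.
Proof. exact: sigma_algebra0. Qed.

Let rV_setC A : g_sigma_preimage coors A -> g_sigma_preimage coors (~` A).
Proof. exact: sigma_algebraC. Qed.

Let rV_bigcup (F : (set 'rV[R]_n)^nat) :
  (forall i, g_sigma_preimage coors (F i)) ->
  g_sigma_preimage coors (\bigcup_i (F i)).
Proof. exact: sigma_algebra_bigcup. Qed.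

HB.instance Definition _ := @isMeasurable.Build rV_display
  'rV[R]_n (g_sigma_preimage coors) rV_set0 rV_setC rV_bigcup.

Lemma measurable_coor (i : 'I_n) :
  measurable_fun [set: 'rV[R]_n] (fun x : 'rV[R]_n => x ord0 i).
Proof.
move=> _ Y mY; rewrite setTI; apply: sub_sigma_algebra => /=.
rewrite -bigcup_seq/=; exists i => /=; first by rewrite mem_index_enum.
by exists Y => //; rewrite setTI.
Qed.

Lemma measurable_fun_coorP d (T : measurableType d) (f : T -> 'rV[R]_n) :
  (forall i, measurable_fun [set: T] (fun t => f t ord0 i)) ->
  measurable_fun [set: T] f.
Proof.
move=> mf _ A mA; rewrite setTI.
suff : g_sigma_preimage coors `<=` [set B | measurable (f @^-1` B)] by exact.
apply: smallest_sub.
  split => /=; first by rewrite preimage_set0.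
    by move=> B mB; rewrite setTD preimage_setC; exact: measurableC.
  by move=> F mF; rewrite preimage_bigcup; exact: bigcup_measurable.
move=> B; rewrite -bigcup_seq/= => -[i _ [C mC <-]] /=.
by rewrite setTI -[X in measurable X]setTI; exact: mf.
Qed.

End measurable_rV.

Section lebesgue_rV.
Context (R : realType).

Definition rV_cons n (z : 'rV[R]_n * R) : 'rV[R]_n.+1 :=
  \row_i (if unlift ord0 i is Some j then z.1 ord0 j else z.2).

Lemma measurable_rV_cons n : measurable_fun setT (@rV_cons n).
Proof.
apply: measurable_fun_coorP => i; rewrite /rV_cons.
under eq_fun do rewrite mxE.
case: unliftP => [j _|_]; last exact: measurable_snd.
exact: (measurableT_comp (measurable_coor j) measurable_fst).
Qed.

(* [lebesgue_rV m.+1] is the image of [lebesgue_rV m \x lebesgue_measure] by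
   [rV_cons]; the named structure only supplies the measurability of
   [rV_cons], which cannot be inferred from the function. *)
Fixpoint lebesgue_rV n : {measure set 'rV[R]_n -> \bar R} :=
  if n is m.+1 then
    measure_function_pushforward__canonical__measure_function_Measure
      (lebesgue_rV m \x @lebesgue_measure R)%E (@measurable_rV_cons m)
  else \d_(0 : 'rV[R]_0).

Lemma lebesgue_rVS m (A : set 'rV[R]_m.+1) :
  lebesgue_rV m.+1 A =
  (lebesgue_rV m \x @lebesgue_measure R)%E (@rV_cons m @^-1` A).
Proof. by []. Qed.

End lebesgue_rV.

Section paths.
Context {R : realType} {n : nat}.
Implicit Types I : set R.

(* [C(I, R^n)] for an interval [I]: such a path is represented by its unique
   extension to [R] that vanishes outside of [I]. *)
Definition paths I : set (R -> 'rV[R]_n) :=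
  [set w : R -> 'rV[R]_n | {within I, continuous w} /\ forall u, ~ I u -> w u = 0].

Definition cpath I : Type := {w : R -> 'rV[R]_n | w \in paths I}.

Definition path_val I (w : cpath I) : R -> 'rV[R]_n := sval w.
Coercion path_val : cpath >-> Funclass.

Lemma paths_mk I (f : R -> 'rV[R]_n) : {within I, continuous f} ->
  (fun u => if u \in I then f u else 0) \in paths I.
Proof.
move=> cf; rewrite inE; split=> [|u Iu]; last by rewrite memNset.
by apply: subspace_eq_continuous cf => u Iu; rewrite /from_subspace Iu.
Qed.

Definition mk_path I (f : R -> 'rV[R]_n) (cf : {within I, continuous f}) :
  cpath I := exist (fun w => w \in paths I) _ (paths_mk cf).

HB.instance Definition _ I := Choice.copy (cpath I)
  {w : R -> 'rV[R]_n | w \in paths I}.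

Let path0_continuous I : {within I, continuous (fun=> 0 : 'rV[R]_n)}.
Proof. by apply: continuous_subspaceT => x; exact: cvg_cst. Qed.

HB.instance Definition _ I := isPointed.Build (cpath I)
  (mk_path (@path0_continuous I)).

Definition path_display : measure_display.
Proof. exact: default_measure_display. Qed.

Definition cylinders I : set (set (cpath I)) :=
  [set A | exists (u : R) (B : set 'rV[R]_n),
    measurable B /\ A = [set w : cpath I | B (w u)]].

HB.instance Definition _ I := @isMeasurable.Build path_display (cpath I)
  <<s @cylinders I >> (@sigma_algebra0 _ setT _) (@sigma_algebraC _ _)
  (@sigma_algebra_bigcup _ setT _).

End paths.
Arguments cpath {R} n I.

Section path_operations.
Context {R : realType} {n : nat}.

Lemma within_time_change (A B : set R) (f : R -> R) (g : R -> 'rV[R]_n) :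
  continuous f -> (forall u, A u -> B (f u)) -> {within B, continuous g} ->
  {within A, continuous (g \o f)}.
Proof.
move=> cf AB; rewrite !subspace_continuousP => cg u Au V nV.
have nB : nbhs (f u) [set v | B v -> V (g v)] := cg _ (AB _ Au) V nV.
change (nbhs u [set v | A v -> V (g (f v))]).
have nA : nbhs u [set v | B (f v) -> V (g (f v))] := cf u _ nB.
by apply: filterS nA => v Vv Av; exact: Vv (AB _ Av).
Qed.

Lemma restrict_continuous (t : R) (w : cpath n `[0, +oo[) :
  {within `[0, t], continuous w}.
Proof.
case: w => w /= /set_mem[cw _]; apply: continuous_subspaceW cw => u /=.
by rewrite !in_itv/= => /andP[->].
Qed.

Lemma reverse_continuous (t : R) (w : cpath n `[0, +oo[) :
  {within `[0, t], continuous (fun u => w (t - u))}.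
Proof.
case: w => w /= /set_mem[cw _].
apply: (@within_time_change _ `[0, +oo[%classic (fun u => t - u)) cw => [u|u /=].
  by apply: cvgB; [exact: cvg_cst|exact: cvg_id].
by rewrite !in_itv/= andbT subr_ge0 => /andP[_].
Qed.

Definition path_restrict (t : R) (w : cpath n `[0, +oo[) : cpath n `[0, t] :=
  mk_path (restrict_continuous (t:=t) (w:=w)).

Definition path_reverse (t : R) (w : cpath n `[0, +oo[) : cpath n `[0, t] :=
  mk_path (reverse_continuous (t:=t) (w:=w)).

End path_operations.

Definition bounded_measurable {R : realType} d (T : measurableType d)
    (f : T -> R) : Prop :=
  measurable_fun setT f /\ exists M : R, forall z, `|f z| <= M.

Section markov.
Context {R : realType} d (S : measurableType d).

(* A conservative transition semigroup on the subset [A] of [S].  Only the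
   values [K t z] with [0 <= t] and [z] in [A] matter. *)
Definition transition_semigroup (A : set S) (K : R -> R.-pker S ~> S) : Prop :=
  [/\ forall t z, 0 <= t -> A z -> K t z A = 1%E,
      forall z B, A z -> measurable B -> K 0 z B = \d_z B
    & forall s t z B, 0 <= s -> 0 <= t -> A z -> measurable B ->
        (K (s + t)%R z B = \int[K s z]_(y in A) K t y B)%E].

(* A Markov semigroup of operators on the bounded measurable functions on [A].
   Such a function is represented by a bounded measurable function on [S], for
   instance its extension by zero, and [V t f] is only considered on [A]. *)
Definition markov_semigroup (A : set S) (V : R -> (S -> R) -> S -> R) : Prop :=
  exists2 K : R -> R.-pker S ~> S, transition_semigroup A K &
    forall t f z, 0 <= t -> bounded_measurable f -> A z ->
      V t f z = (\int[K t z]_(y in A) f y)%R.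

Context {d'} {T : measurableType d'}.

Definition past (Y : R -> T -> S) (s : R) : set (set T) :=
  <<s [set A | exists u (B : set S),
         [/\ 0 <= u <= s, measurable B & A = Y u @^-1` B]] >>.

(* Under [mu], [Y] is a (time-homogeneous) Markov process with transition
   kernels [K], with respect to its own filtration. *)
Definition markov_process (mu : {measure set T -> \bar R}) (Y : R -> T -> S)
    (K : R -> R.-pker S ~> S) : Prop :=
  forall s t A B, 0 <= s -> 0 <= t -> past Y s A -> measurable B ->
    (mu (A `&` Y (s + t)%R @^-1` B) = \int[mu]_(w in A) K t (Y s w) B)%E.

End markov.

Section diffusion.
Context {R : realType} {n : nat}.
Notation Rn := 'rV[R]_n.
Notation Omega := (cpath n `[0 : R, +oo[).

Definition X (t : R) (w : Omega) : Rn := w t.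

Definition started_at (P : R.-pker Rn ~> Omega) : Prop :=
  forall x, P x [set w | X 0 w = x] = 1%E.

Definition markov_family (P : R.-pker Rn ~> Omega) : Prop :=
  exists K : R -> R.-pker Rn ~> Rn, forall x, markov_process (P x) X K.

(* Standard [n]-dimensional Brownian motion, relative to the filtration [F]. *)
Definition brownian_motion (mu : {measure set Omega -> \bar R})
    (F : R -> set (set Omega)) (W : R -> Omega -> Rn) : Prop :=
  [/\ forall w, W 0 w = 0,
      forall w, {within `[0, +oo[, continuous (fun t => W t w)},
      forall t B, 0 <= t -> measurable B -> F t (W t @^-1` B)
    & forall s t A (B : 'I_n -> set R), 0 <= s -> s < t -> F s A ->
        (forall i, measurable (B i)) ->
        (mu (A `&` [set w | forall i, B i (W t w ord0 i - W s w ord0 i)%R]) =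
         mu A * \prod_(i < n) normal_prob 0 (Num.sqrt (t - s)) (B i))%E].

(* [W(t) = X(t) - X(0) + \int_0^t beta(X(s)) ds]. *)
Definition driving_noise (beta : Rn -> Rn) (t : R) (w : Omega) : Rn :=
  \row_i (X t w ord0 i - X 0 w ord0 i +
          \int[lebesgue_measure]_(s in `[0, t]) beta (X s w) ord0 i).

(* The noise being additive, the SDE is the pathwise identity defining
   [driving_noise], for a Brownian motion [W]. *)
Definition diffusion (beta : Rn -> Rn) (P : R.-pker Rn ~> Omega) : Prop :=
  [/\ started_at P, markov_family P &
      forall x, brownian_motion (P x) (past X) (driving_noise beta)].

Definition gradient (gamma : Rn -> R) (x : Rn) : Rn :=
  \row_i ('D_(delta_mx ord0 i) gamma x).

Definition stationary_density (gamma : Rn -> R) (x : Rn) : R := expR (- 2 * gamma x).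

Definition transition_density (P : R.-pker Rn ~> Omega)
    (p : R -> Rn -> Rn -> R) : Prop :=
  forall t, 0 < t ->
    [/\ measurable_fun setT (fun z : Rn * Rn => p t z.1 z.2),
        forall x y, 0 <= p t x y
      & forall x B, measurable B ->
          (P x (X t @^-1` B) = \int[lebesgue_rV R n]_(y in B) (p t x y)%:E)%E].

Definition diffusion_semigroup (P : R.-pker Rn ~> Omega)
    (t : R) (f : Rn -> R) (x : Rn) : R :=
  (\int[P x]_w f (X t w))%R.

End diffusion.

Section linked.
Context {R : realType} {n : nat} {Dbar : ptopologicalType}.
Notation Rn := 'rV[R]_n.
Notation Omega := (cpath n `[0 : R, +oo[).
Variable Dstar : set Dbar.
Variable Psi : forall t : R, borel Dbar * cpath n `[0, t] -> borel Dbar.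

Definition Psi_at (xs : Dbar) (t : R) (w : Omega) : Dbar :=
  Psi (xs, path_restrict t w).

Definition lifetime (xs : Dbar) (w : Omega) : \bar R :=
  ereal_inf [set t%:E | t in [set t | 0 <= t /\ ~ Dstar (Psi_at xs t w)]].

Definition dynamical_system : Prop :=
  (forall t, 0 <= t -> measurable_fun setT (@Psi t)) /\
  forall xs (w : Omega), Dstar xs ->
    Psi_at xs 0 w = xs /\
    {within [set t | 0 <= t /\ (t%:E < lifetime xs w)%E],
       continuous (fun t => Psi_at xs t w)}.

Definition joint_process (xs : Dbar) (t : R) (w : Omega) : borel Dbar * Rn :=
  (Psi_at xs t w, X t w).

(* [(Psi_t(x^*, X), X(t))] is Markovian whenever [X] is: the transition
   kernels depend neither on [x^*] nor on the initial position of [X]. *)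
Definition preserves_markov : Prop :=
  forall P : R.-pker Rn ~> Omega, started_at P -> markov_family P ->
    exists K : R -> R.-pker (borel Dbar * Rn)%type ~> (borel Dbar * Rn)%type,
      forall xs x, Dstar xs -> markov_process (P x) (joint_process xs) K.

Definition coupled_semigroup (P : R.-pker Rn ~> Omega)
    (t : R) (g : borel Dbar * Rn -> R) (z : borel Dbar * Rn) : R :=
  (\int[P z.2]_w g (joint_process z.1 t w))%R.

(* [V] is a Markov semigroup on [E], linked between the semigroups [P] on
   [R^n] and [Q] on [Ds], with link [lambda]; [Q t F xs] stands for
   [\int Q_t(xs, dy) F(y)]. *)
Definition Lambda_linked (Ds : set (borel Dbar)) (E : set (borel Dbar * Rn))
    (V : R -> (borel Dbar * Rn -> R) -> borel Dbar * Rn -> R)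
    (P : R -> (Rn -> R) -> Rn -> R)
    (Q : R -> (borel Dbar -> R) -> borel Dbar -> R)
    (lambda : borel Dbar -> Rn -> R) : Prop :=
  [/\ markov_semigroup setT P, markov_semigroup Ds Q, markov_semigroup E V,
      forall t g f, 0 <= t -> bounded_measurable g -> bounded_measurable f ->
        (forall z, E z -> g z = f z.2) ->
        forall z, E z -> V t g z = P t f z.2
    & forall t xs g, 0 <= t -> Ds xs -> bounded_measurable g ->
        (\int[lebesgue_rV R n]_x (lambda xs x * V t g (xs, x)))%R =
        Q t (fun ys => \int[lebesgue_rV R n]_y (lambda ys y * g (ys, y)))%R xs].

Variables (Gamma : borel Dbar * Rn -> R) (nu : Rn -> R).

Definition state_space : set (Dbar * Rn) :=
  [set z | Dstar z.1 /\ 0 < Gamma z].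

Definition total_mass (xs : borel Dbar) : R :=
  (\int[lebesgue_rV R n]_x (Gamma (xs, x) * nu x))%R.

Definition link (xs : borel Dbar) (x : Rn) : R :=
  Gamma (xs, x) / total_mass xs * nu x.

(* [Q^*_t f = Q_t [h f] / h], where [h] is [total_mass]. *)
Definition conjugate_semigroup (Q : R -> R.-pker borel Dbar ~> borel Dbar)
    (t : R) (f : borel Dbar -> R) (xs : borel Dbar) : R :=
  (total_mass xs)^-1 * (\int[Q t xs]_ys (total_mass ys * f ys))%R.

End linked.

(* Main.v *)
Require Import Defs.
From HB Require Import structures.
From mathcomp Require Import all_boot all_order all_algebra.
From mathcomp Require Import all_classical all_reals all_analysis.
From mathcomp Require Import measurable_realfun.

Set Implicit Arguments.
Unset Strict Implicit.
Unset Printing Implicit Defensive.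

Import Order.TTheory GRing.Theory Num.Theory.
Import numFieldNormedType.Exports.

Local Open Scope classical_set_scope.
Local Open Scope ring_scope.

(** The diffusion is reversible: the symmetry of [nu x * p t x y] makes its
    operators self-adjoint with respect to [nu dx] ([reversible_density]), and
    by the Markov property a path on [0, t] started from the possibly infinite
    measure [nu dx] has the same law as its reversal
    ([integral_reverse_path]).  On finite-dimensional events this is
    [reverse_follows], and these events determine the sigma-finite law.

    The link rests on one duality ([flow_duality]).  Integrate
    [Gamma (xs, X 0) * g (Psi t (xs, X), X t)] when [X 0] has law [nu dx].  By
    [hyp_a] the factor [Gamma] can be evaluated at time [t], at
    [(Psi t (xs, X), X t)].  Reversing the path turns that pair into the flow
    driven by the reversed path together with the starting point [x].  By
    [hyp_b] this flow has law [Q t xs] whatever [x] is, so the integrals over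
    the flow and over [nu dx] separate:

      \int nu x * Gamma (xs, x) * V t g (xs, x) dx =
        \int Q t (xs, dy) \int nu x * Gamma (y, x) * g (y, x) dx.

    After division by the total mass [h xs] this is the intertwining relation
    ([link_intertwines]).  For [g = 1] it says that [h] is invariant under [Q]
    ([total_mass_invariant]), so that the conjugate of [Q] by [h] is again a
    Markov semigroup, on the set where [h] is positive
    ([transformed_semigroup]).

    The other two semigroups come from Markov processes: the kernels given by
    the Markov property between the times 0 and [t] are the laws of the process
    started at a point ([markov_processes_semigroup]).  The joint process stays
    in the state space because [Gamma] is constant along it and vanishes on the
    boundary. *)

(** * Mixtures and densities of measures *)

Section mixtures.
Context d d' (S : measurableType d) (T : measurableType d') (R : realType).
Local Open Scope ereal_scope.
Import HBNNSimple.

(** If [m] is the average of the measures [k x] under [mu], then integrals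
    against [m] are averages too.  This one statement covers the passage from
    sets to functions for densities, transition kernels and Markov
    properties; both sides commute with increasing limits of simple
    functions. *)
Lemma integral_mixture (mu : {measure set S -> \bar R})
    (k : S -> {measure set T -> \bar R}) (m : {measure set T -> \bar R})
    (f : T -> \bar R) :
  (forall U, measurable U -> measurable_fun setT (k ^~ U)) ->
  (forall U, measurable U -> m U = \int[mu]_x k x U) ->
  (forall y, 0 <= f y) -> measurable_fun setT f ->
  \int[m]_y f y = \int[mu]_x \int[k x]_y f y.
Proof.
move=> mk mE f0 mf; pose g := nnsfun_approx measurableT mf.
have mg n : measurable_fun setT (fun y => (g n y)%:E) by exact/measurable_EFinP.
have g0 n y : 0 <= (g n y)%:E by rewrite lee_fin.
have ndg y : {homo (fun n => (g n y)%:E) : p q / (p <= q)%N >-> p <= q}.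
  by move=> p q pq; rewrite lee_fin; exact/lefP/nd_nnsfun_approx.
have limg (m' : {measure set T -> \bar R}) :
    \int[m']_y f y = limn (fun n => \int[m']_y (g n y)%:E).
  rewrite -monotone_convergence//; apply: eq_integral => y _.
  by apply/esym/cvg_lim => //; exact: cvg_nnsfun_approx.
have gE n (m' : {measure set T -> \bar R}) :
    \int[m']_y (g n y)%:E =
    \sum_(r \in range (g n)) r%:E * m' (g n @^-1` [set r]).
  by rewrite integralT_nnsfun sintegralE.
rewrite limg; under eq_integral do rewrite limg.
rewrite monotone_convergence//.
- congr (limn _); apply/funext => n; rewrite gE.
  under eq_integral do rewrite gE.
  rewrite ge0_integral_fsum//.
  + apply: eq_fsbigr => r _; rewrite mE//.
    (* A simple function that is nonnegative does not take the value r < 0. *)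
    have [r0|r0] := leP 0%R r.
      by rewrite ge0_integralZl_EFin//; exact: mk.
    rewrite preimage_nnfun0//; transitivity (0 : \bar R).
      by rewrite integral0_eq ?mule0// => x _; rewrite measure0.
    by rewrite integral0_eq// => x _; rewrite measure0 mule0.
  + by move=> r; apply: measurable_funeM; exact: mk.
  + by move=> r x _; 
    by apply: (mulemu_ge0 (fun r => g n @^-1` [set r])) => r0; rewrite preimage_nnfun0.
- by move=> n; apply: measurable_fun_integral_kernel.
- by move=> n x _; exact: integral_ge0.
- by move=> x _ p q pq; apply: ge0_le_integral => // y _; exact: ndg.
Qed.

Definition mixture (mu : {measure set S -> \bar R})
  (k : S -> {measure set T -> \bar R})
  (mk : forall U, measurable U -> measurable_fun setT (k ^~ U)) (U : set T) :=
  \int[mu]_x k x U.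

Section mixture_measure.
Variables (mu : {measure set S -> \bar R}) (k : S -> {measure set T -> \bar R}).
Variable mk : forall U, measurable U -> measurable_fun setT (k ^~ U).

Let mixture0 : mixture mu mk set0 = 0.
Proof. by rewrite /mixture integral0_eq// => x _; rewrite measure0. Qed.

Let mixture_ge0 U : 0 <= mixture mu mk U.
Proof. exact: integral_ge0. Qed.

Let mixture_semi_sigma_additive : semi_sigma_additive (mixture mu mk).
Proof.
move=> U mU tU mUU; rewrite [X in _ --> X](_ : _ =
  \int[mu]_x (\sum_(n <oo) k x (U n))); last first.
  apply: eq_integral => x _.
  by apply/esym/cvg_lim => //; exact/measure_semi_sigma_additive.
apply/cvg_closeP; split.
  by apply: is_cvg_nneseries => n _ _; exact: integral_ge0.
by rewrite closeE// integral_nneseries// => n; exact: mk.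
Qed.

HB.instance Definition _ := isMeasure.Build _ _ _ (mixture mu mk)
  mixture0 mixture_ge0 mixture_semi_sigma_additive.

End mixture_measure.

End mixtures.

Lemma restrict_indic (T : Type) (R : realType) (A : set T) (f : T -> \bar R) x :
  (f \_ A) x = ((\1_A x)%:E * f x)%E.
Proof. by rewrite patchE indicE; case: ifPn; rewrite ?mul1e ?mul0e. Qed.

Section densities.
Context d (S : measurableType d) (R : realType).
Local Open Scope ereal_scope.
Variables (h : S -> R) (h0 : forall x, (0 <= h x)%R).
Hypothesis mh : measurable_fun setT h.

(** The kernel [h(x) dirac_x]: mixing it with respect to [mu] gives the
    measure of density [h] with respect to [mu]. *)
Definition scaled_dirac (x : S) : {measure set S -> \bar R} :=
  mscale (NngNum (h0 x)) \d_x.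

Lemma scaled_diracE x U : scaled_dirac x U = (h x)%:E * (\1_U x)%:E.
Proof. by rewrite /= /mscale/= diracE indicE. Qed.

Lemma measurable_scaled_dirac U : measurable U ->
  measurable_fun setT (scaled_dirac ^~ U).
Proof.
move=> mU; under eq_fun do rewrite scaled_diracE.
by apply: emeasurable_funM; apply/measurable_EFinP => //; exact: measurable_indic.
Qed.

Lemma integral_scaled_dirac x (f : S -> \bar R) : (forall y, 0 <= f y) ->
  measurable_fun setT f -> \int[scaled_dirac x]_y f y = (h x)%:E * f x.
Proof.
move=> f0 mf; rewrite ge0_integral_mscale//= integral_dirac//.
by rewrite diracT mul1e.
Qed.

(** A measure that has the density [h] on sets has it on functions. *)
Lemma integral_density (mu m : {measure set S -> \bar R}) (f : S -> \bar R) :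
  (forall U, measurable U -> m U = \int[mu]_(x in U) (h x)%:E) ->
  measurable_fun setT f ->
  \int[m]_y f y = \int[mu]_x ((h x)%:E * f x).
Proof.
move=> mE mf.
have pos g : (forall y, 0 <= g y) -> measurable_fun setT g ->
    \int[m]_y g y = \int[mu]_x ((h x)%:E * g x).
  move=> g0 mg; rewrite (@integral_mixture _ _ _ _ _ mu scaled_dirac)//.
  - by apply: eq_integral => x _; rewrite integral_scaled_dirac.
  - exact: measurable_scaled_dirac.
  - move=> U mU; rewrite mE// integral_mkcond; apply: eq_integral => x _.
    by rewrite scaled_diracE restrict_indic muleC.
rewrite integralE [RHS]integralE; congr (_ - _).
- rewrite pos//; last exact: measurable_funepos.
  by apply: eq_integral => x _; rewrite !funeposE maxe_pMr ?lee_fin// mule0.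
- rewrite pos//; last exact: measurable_funeneg.
  by apply: eq_integral => x _; rewrite !funenegE maxe_pMr ?lee_fin// mule0 muleN.
Qed.

Definition density_measure (mu : {measure set S -> \bar R}) :
  {measure set S -> \bar R} := mixture mu measurable_scaled_dirac.

Lemma density_measureE mu U :
  density_measure mu U = \int[mu]_(x in U) (h x)%:E.
Proof.
rewrite integral_mkcond; apply: eq_integral => x _.
by rewrite scaled_diracE restrict_indic muleC.
Qed.

Lemma integral_density_measure (mu : {measure set S -> \bar R})
    (f : S -> \bar R) : measurable_fun setT f ->
  \int[density_measure mu]_y f y = \int[mu]_x ((h x)%:E * f x).
Proof. by move=> mf; apply: integral_density => // U _; exact: density_measureE. Qed.

End densities.

(** * Almost sure equalities *)

Section ae_equality.
Context d (T : measurableType d) (R : realType).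
Local Open Scope ereal_scope.

Lemma probability_compl_eq0 (P : {measure set T -> \bar R}) A : P setT = 1 ->
  measurable A -> P A = 1 -> P (~` A) = 0.
Proof.
move=> P1 mA PA.
have PTfin : P setT < +oo by rewrite P1 ltry.
have -> : P (~` A) = P setT - P A by rewrite -setTD measureD// setTI.
by rewrite P1 PA subee.
Qed.

Lemma eq_integral_full (P : {measure set T -> \bar R}) A (f g : T -> \bar R) :
  P setT = 1 -> measurable A -> P A = 1 ->
  measurable_fun setT f -> measurable_fun setT g ->
  (forall w, A w -> f w = g w) -> \int[P]_w f w = \int[P]_w g w.
Proof.
move=> P1 mA PA mf mg fg; apply: ae_eq_integral => //.
exists (~` A); split; first exact: measurableC.
  exact: probability_compl_eq0.
by move=> w /= nfg Aw; apply: nfg => _; exact: fg.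
Qed.

Lemma full_setI (P : {measure set T -> \bar R}) A B : P setT = 1 ->
  measurable A -> measurable B -> P A = 1 -> P (A `&` B) = P B.
Proof.
move=> P1 mA mB PA.
have -> : P B = P (B `\` A) + P (B `&` A) := measureDI P mB mA.
have -> : P (B `\` A) = 0; last by rewrite add0e setIC.
apply: (@subset_measure0 _ _ _ _ _ (~` A)) => //; first exact: measurableD.
  exact: measurableC.
exact: probability_compl_eq0.
Qed.

(** An almost surely constant variable has a Dirac law. *)
Lemma law_constant d' (S : measurableType d') (P : {measure set T -> \bar R})
    (Y : T -> S) z D B : P setT = 1 -> measurable D -> P D = 1 ->
  measurable_fun setT Y -> measurable B -> (forall w, D w -> Y w = z) ->
  P (Y @^-1` B) = \d_z B.
Proof.
move=> P1 mD PD mY mB Yz.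
have mYB : measurable (Y @^-1` B).
  by rewrite -[X in measurable X]setTI; exact: mY.
rewrite -(full_setI P1 mD mYB PD) diracE.
have [zB|zB] := boolP (z \in B).
  by rewrite setIidl// => w /Yz E; rewrite /preimage/= E; exact: set_mem.
rewrite (_ : _ `&` _ = set0) ?measure0//.
apply/seteqP; split => // w [/Yz E] /=; rewrite E => /mem_set.
by rewrite (negbTE zB).
Qed.

End ae_equality.

(** * Tonelli's theorem for sigma-finite measures *)

Section sigma_finite_structure.
Context d (T : measurableType d) (R : realType).
Variables (mu : {measure set T -> \bar R}) (smu : sigma_finite setT mu).

(** The structures for the theorem of Tonelli are attached to a constant, since
    they cannot be attached to the variable [mu] itself. *)
Definition sigma_finite_copy of sigma_finite setT mu : set T -> \bar R := mu.

HB.instance Definition _ := Measure.copy (sigma_finite_copy smu) mu.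
HB.instance Definition _ :=
  Measure_isSigmaFinite.Build _ _ _ (sigma_finite_copy smu) smu.

End sigma_finite_structure.

Section tonelli.
Context d d' (S : measurableType d) (T : measurableType d') (R : realType).
Local Open Scope ereal_scope.

Lemma sigma_finite_tonelli (mu : {measure set S -> \bar R})
    (nu : {measure set T -> \bar R}) (f : S * T -> \bar R) :
  sigma_finite setT mu -> sigma_finite setT nu ->
  (forall z, 0 <= f z) -> measurable_fun setT f ->
  \int[mu]_x \int[nu]_y f (x, y) = \int[nu]_y \int[mu]_x f (x, y).
Proof.
move=> smu snu f0 mf.
exact: (@sfinite_Fubini _ _ _ _ _ (sigma_finite_copy smu)
  (sigma_finite_copy snu)).
Qed.

Lemma measurable_section_integral (nu : {measure set T -> \bar R})
    (f : S * T -> \bar R) : sigma_finite setT nu ->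
  (forall z, 0 <= f z) -> measurable_fun setT f ->
  measurable_fun setT (fun x => \int[nu]_y f (x, y)).
Proof.
move=> snu f0 mf.
exact: (@measurable_fun_fubini_tonelli_F _ _ _ _ _ (sigma_finite_copy snu)).
Qed.

End tonelli.

(** * Euclidean space *)

Section euclidean.
Context (R : realType).

Definition cube n (k : nat) : set 'rV[R]_n :=
  [set x | forall i, `|x ord0 i| <= k%:R].

Lemma measurable_coor_preimage n (i : 'I_n) (B : set R) : measurable B ->
  measurable [set x : 'rV[R]_n | B (x ord0 i)].
Proof. by move=> mB; rewrite -[X in measurable X]setTI; exact: measurable_coor. Qed.

Lemma measurable_forall_ord d (T : measurableType d) n (A : 'I_n -> set T) :
  (forall i, measurable (A i)) -> measurable [set x | forall i, A i x].
Proof.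
move=> mA; rewrite (_ : mkset _ = \bigcap_(i in [set: 'I_n]) A i); last first.
  by apply/seteqP; split => [x Ax i _|x Ax i]; exact: Ax.
by apply: fin_bigcap_measurable => //; exact: finite_finset.
Qed.

Lemma measurable_cube n k : measurable (@cube n k).
Proof.
apply: measurable_forall_ord => i.
apply: (@measurable_coor_preimage _ i [set r | `|r| <= k%:R]).
rewrite (_ : mkset _ = `[- k%:R, k%:R]%classic)//.
by apply/seteqP; split=> r /=; rewrite in_itv/= ler_norml.
Qed.

Lemma cube_cover n : \bigcup_k @cube n k = setT.
Proof.
apply/seteqP; split => // x _.
exists (\max_(i < n) Num.bound `|x ord0 i|)%N => // i.
apply: (@le_trans _ _ (Num.bound `|x ord0 i|)%:R).
  by apply: ltW; exact: archi_boundP.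
rewrite ler_nat.
exact: (@leq_bigmax _ (fun i => Num.bound `|x ord0 i|)).
Qed.

(** By induction on the dimension: a cube is the product of a cube and an
    interval. *)
Lemma lebesgue_cube_fin n k : (lebesgue_rV R n (cube k) < +oo)%E.
Proof.
elim: n => [|n IHn] /=; first by rewrite diracE ltry.
rewrite /pushforward /= (_ : _ @^-1` _ = cube k `*` `[- k%:R, k%:R]%classic).
  rewrite product_measure1E//; last exact: measurable_cube.
  apply: lte_mul_pinfty => //.
    by rewrite ge0_fin_numE.
  rewrite [ltLHS]lebesgue_measure_itv/=; case: ifPn => // _.
  by rewrite -EFinB ltry.
apply/seteqP; split => -[x r] /=; rewrite in_itv/= -ler_norml.
- move=> xr; split.
    by move=> i; have := xr (lift ord0 i); rewrite mxE liftK.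
  by have := xr ord0; rewrite mxE unlift_none.
- by move=> [xk rk] i; rewrite mxE; case: unliftP => //.
Qed.

Lemma lebesgue_rV_sigma_finite n : sigma_finite setT (lebesgue_rV R n).
Proof.
exists (@cube n); first by rewrite cube_cover.
by move=> k; split; [exact: measurable_cube|exact: lebesgue_cube_fin].
Qed.

Lemma measurable_rV_set1 n (x : 'rV[R]_n) : measurable [set x].
Proof.
rewrite (_ : [set x] = [set y | forall i, y ord0 i = x ord0 i]); last first.
  by apply/seteqP; split => [y -> //|y yx]; apply/rowP.
by apply: measurable_forall_ord => i;
  apply: (@measurable_coor_preimage _ i [set x ord0 i]).
Qed.

(** The sup-norm ball of radius [1 / (k + 1)] around a rational point. *)
Definition rational_box n (q : 'rV[rat]_n) (k : nat) : set 'rV[R]_n :=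
  [set x | forall i, `|ratr (q ord0 i) - x ord0 i| < k.+1%:R^-1].

Lemma measurable_rational_box n (q : 'rV[rat]_n) k :
  measurable (rational_box q k).
Proof.
apply: measurable_forall_ord => i.
apply: (@measurable_coor_preimage _ i
  [set r : R | `|ratr (q ord0 i) - r| < k.+1%:R^-1]).
by rewrite -[mkset _]/(ball _ _); exact: measurable_ball.
Qed.

Lemma rational_box_near n (x : 'rV[R]_n) k : exists q, rational_box q k x.
Proof.
have near i : exists q : rat, `|ratr q - x ord0 i| < k.+1%:R^-1.
  have : x ord0 i - k.+1%:R^-1 < x ord0 i + k.+1%:R^-1.
    by rewrite ltrD2l gtrN.
  move=> /rat_in_itvoo[q]; rewrite in_itv/= => /andP[q1 q2].
  by exists q; rewrite ltr_distl q1.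
exists (\row_i (projT1 (cid (near i)))) => i.
by rewrite mxE; case: (cid _).
Qed.

(** The topology of [R^n] has a countable base of boxes, so that the open sets
    belong to the product sigma-algebra. *)
Lemma open_measurable_rV n (U : set 'rV[R]_n) : open U -> measurable U.
Proof.
move=> oU; rewrite (_ : U = \bigcup_(p in [set p : 'rV[rat]_n * nat |
    rational_box p.1 p.2 `<=` U]) rational_box p.1 p.2).
  rewrite bigcup_mkcond; apply: countable_bigcupT_measurable => // p.
  by case: ifP => // _; exact: measurable_rational_box.
apply/seteqP; split => [x Ux|x [p pU]]; last exact: pU.
have /nbhs_ballP[e e0 xeU] : nbhs x U by exact: open_nbhs_nbhs.
(* A box of radius below e / 2 that contains x lies in the ball of radius e
   around x. *)
have [k ke] : exists k, k.+1%:R^-1 < e / 2.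
  have e20 : 0 < e / 2 by rewrite divr_gt0.
  near \oo => k; exists k; near: k.
  exact: near_infty_natSinv_lt (PosNum e20).
have [q xq] := rational_box_near x k.
exists (q, k) => //= y yq; apply: xeU; split => // i j.
rewrite /ball/= (ord1 i) (splitr e).
have := xq j; have := yq j; rewrite distrC => h1 h2.
rewrite (le_lt_trans (ler_distD (ratr (q ord0 j)) _ _))// ltrD//.
  by rewrite distrC (lt_trans h2).
by rewrite distrC (lt_trans h1).
Unshelve. all: by end_near. Qed.

Lemma continuous_measurable_rV n (f : 'rV[R]_n -> R) : continuous f ->
  measurable_fun setT f.
Proof.
move=> /continuousP cf.
apply: (measurability _ (RGenOpens.measurableE R)).
move=> _ [_ [a [b ->] <-]]; rewrite setTI; apply: open_measurable_rV.
by apply: cf; exact: interval_open.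
Qed.

End euclidean.

(** * Markov processes and their transition semigroups *)

Section laws.
Context d d' (T : measurableType d) (S : measurableType d') (R : realType).
Local Open Scope ereal_scope.

Definition image_measure (mu : {measure set T -> \bar R}) (Y : T -> S)
    (mY : measurable_fun setT Y) : {measure set S -> \bar R} :=
  measure_function_pushforward__canonical__measure_function_Measure mu mY.

(** For functions of any sign: the positive and the negative part are
    transported separately. *)
Lemma integral_law (mu : {measure set T -> \bar R}) (Y : T -> S)
    (nu : {measure set S -> \bar R}) (f : S -> \bar R) :
  measurable_fun setT Y ->
  (forall B, measurable B -> nu B = mu (Y @^-1` B)) ->
  measurable_fun setT f -> \int[nu]_z f z = \int[mu]_w f (Y w).
Proof.
move=> mY nuE mf.
have pos (g : S -> \bar R) : (forall z, 0 <= g z) -> measurable_fun setT g ->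
    \int[nu]_z g z = \int[mu]_w g (Y w).
  move=> g0 mg; rewrite -(@ge0_integral_pushforward _ _ _ _ _ _ mY _ setT)//.
  by apply: (@eq_measure_integral _ _ _ _ (image_measure mu mY)) => B mB _; exact: nuE.
rewrite integralE [RHS]integralE; congr (_ - _).
- rewrite pos//; last exact: measurable_funepos.
  by apply: eq_integral => w _; rewrite !funeposE.
- rewrite pos//; last exact: measurable_funeneg.
  by apply: eq_integral => w _; rewrite !funenegE.
Qed.

Lemma past_measurable (Y : R -> T -> S) s :
  (forall u, 0 <= u -> measurable_fun setT (Y u))%R ->
  past Y s `<=` measurable.
Proof.
move=> mY; apply: smallest_sub; first exact: sigma_algebra_measurable.
move=> _ [u [B [/andP[u0 _] mB ->]]].
by rewrite -[X in measurable X]setTI; exact: mY.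
Qed.

Lemma past_homo (Y : R -> T -> S) s t : (s <= t)%R -> past Y s `<=` past Y t.
Proof.
move=> st; apply: sub_sigma_algebra2 => A [u [B [/andP[u0 us] mB ->]]].
by exists u, B; split => //; rewrite u0 (le_trans us).
Qed.

Lemma past_preimage (Y : R -> T -> S) s u B : (0 <= u <= s)%R -> measurable B ->
  past Y s (Y u @^-1` B).
Proof. by move=> us mB; apply: sub_sigma_algebra; exists u, B. Qed.

Lemma past_setI (Y : R -> T -> S) s A B : past Y s A -> past Y s B ->
  past Y s (A `&` B).
Proof.
move=> YA YB.
exact: (@measurableI _ (g_sigma_algebraType [set A | exists u (B : set S),
         [/\ (0 <= u <= s)%R, measurable B & A = Y u @^-1` B]])).
Qed.

Lemma past_setT (Y : R -> T -> S) s : past Y s setT.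
Proof.
exact: (@measurableT _ (g_sigma_algebraType [set A | exists u (B : set S),
         [/\ (0 <= u <= s)%R, measurable B & A = Y u @^-1` B]])).
Qed.

End laws.

Section markov_semigroups.
Context d d' (S : measurableType d) (T : measurableType d') (R : realType).
Local Open Scope ereal_scope.
Variables (mu : {measure set T -> \bar R}) (Y : R -> T -> S).
Variable K : R -> R.-pker S ~> S.
Hypothesis mY : forall u, (0 <= u)%R -> measurable_fun setT (Y u).
Hypothesis mkY : markov_process mu Y K.

(** The Markov property, stated for events, extends to functions: on [A] the
    law of [Y (s + t)] is the mixture of the laws [K t (Y s w)]. *)
Lemma markov_process_integral s t A (f : S -> \bar R) :
  (0 <= s)%R -> (0 <= t)%R -> past Y s A ->
  (forall z, 0 <= f z) -> measurable_fun setT f ->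
  \int[mu]_(w in A) f (Y (s + t)%R w) =
  \int[mu]_(w in A) \int[K t (Y s w)]_z f z.
Proof.
move=> s0 t0 YA f0 mf.
have mA : measurable A by exact: past_measurable YA.
have mst : measurable_fun setT (Y (s + t)%R) by apply: mY; exact: addr_ge0.
have mK U : measurable U -> measurable_fun setT (fun w => K t (Y s w) U).
  move=> mU; apply: (@measurableT_comp _ _ _ _ _ _ (fun z => K t z U)).
    exact: measurable_kernel.
  exact: mY.
have restrE (g : T -> \bar R) : (forall w, 0 <= g w) -> measurable_fun setT g ->
    \int[mu]_(w in A) g w = \int[mrestr mu mA]_w g w.
  move=> g0 mg.
  rewrite (@integral_density _ _ _ (\1_A : T -> R) _ _ mu (mrestr mu mA))//.
  - rewrite integral_mkcond; apply: eq_integral => w _.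
    by rewrite restrict_indic.
  - by move=> U mU; rewrite integral_indic// setIC.
rewrite (restrE (fun w => f (Y (s + t)%R w)))//; last exact: measurableT_comp.
rewrite (restrE (fun w => \int[K t (Y s w)]_z f z)); last 2 first.
- by move=> w; exact: integral_ge0.
- exact: measurable_fun_integral_kernel.
rewrite -(@integral_law _ _ _ _ _ (mrestr mu mA) _
  (image_measure (mrestr mu mA) mst))//.
apply: integral_mixture => // U mU.
rewrite -restrE//; last exact: mK.
by rewrite -mkY// setIC.
Qed.

(** The Markov property between the times 0 and [t] identifies [K t z] as the
    law of [Y t] when the process starts at [z]. *)
Lemma markov_process_law z D : mu setT = 1 -> measurable D -> mu D = 1 ->
  (forall w, D w -> Y 0 w = z) ->
  forall t B, (0 <= t)%R -> measurable B -> mu (Y t @^-1` B) = K t z B.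
Proof.
move=> mu1 mD muD D0 t B t0 mB.
have := mkY (lexx 0) t0 (@past_setT _ _ _ _ _ Y 0) mB.
rewrite setTI add0r => ->.
rewrite (@eq_integral_full _ _ _ mu D _ (fun=> K t z B))//.
- by rewrite integral_cst//= mu1 mule1.
- apply: (@measurableT_comp _ _ _ _ _ _ (fun z => K t z B)).
    exact: measurable_kernel.
  exact: mY.
- by move=> w /D0 ->.
Qed.

End markov_semigroups.

(** A family of Markov processes with common kernels, one started at each point
    of [A] and staying in [A], defines a Markov semigroup on [A]: [K t z] is
    then the law at time [t] of the process started at [z], and the Markov
    property at time [s] is the Chapman-Kolmogorov equation. *)
Lemma markov_processes_semigroup d d' (S : measurableType d)
    (T : measurableType d') (R : realType) (A : set S)
    (mu : S -> {measure set T -> \bar R}) (Y : S -> R -> T -> S)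
    (D : S -> set T) (K : R -> R.-pker S ~> S) :
  measurable A ->
  (forall z, A z -> [/\ mu z setT = 1%E, measurable (D z), mu z (D z) = 1%E &
    forall w, D z w -> Y z 0 w = z /\ forall t, 0 <= t -> A (Y z t w)]) ->
  (forall z t, A z -> 0 <= t -> measurable_fun setT (Y z t)) ->
  (forall z, A z -> markov_process (mu z) (Y z) K) ->
  markov_semigroup A (fun t f z => (\int[mu z]_w f (Y z t w))%R).
Proof.
move=> mA start mY mkY.
have law z t B : A z -> 0 <= t -> measurable B ->
    mu z (Y z t @^-1` B) = K t z B.
  move=> Az t0 mB; have [mu1 mD muD D0] := start z Az.
  apply: (@markov_process_law _ _ _ _ _ (mu z) (Y z) K _ _ z (D z)) => //.
  - by move=> u u0; exact: mY.
  - exact: mkY.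
  - by move=> w /D0[].
have KA t z : 0 <= t -> A z -> K t z A = 1%E.
  move=> t0 Az; have [mu1 mD muD D0] := start z Az.
  rewrite -law//; apply/eqP; rewrite eq_le; apply/andP; split.
    rewrite -mu1; apply: le_measure; rewrite ?inE//.
    by rewrite -[X in measurable X]setTI; exact: mY.
  rewrite -muD; apply: le_measure; rewrite ?inE//.
    by rewrite -[X in measurable X]setTI; exact: mY.
  by move=> w /D0[_]; exact.
have K_A t z (f : S -> \bar R) : 0 <= t -> A z -> measurable_fun setT f ->
    (\int[K t z]_(y in A) f y = \int[K t z]_y f y)%E.
  move=> t0 Az mf; rewrite integral_mkcond.
  apply: (@eq_integral_full _ _ _ _ A) => //.
  - exact: prob_kernel.
  - exact: KA.
  - by apply/(measurable_restrictT _ mA); exact: measurable_funTS.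
  - by move=> w Aw; rewrite patchE mem_set.
exists K; first split.
- exact: KA.
- move=> z B Az mB; have [mu1 mD muD D0] := start z Az.
  rewrite -law//.
  apply: (law_constant mu1 mD muD) => //; first exact: mY.
  by move=> w /D0[].
- move=> s t z B s0 t0 Az mB.
  rewrite -law ?addr_ge0//.
  have := mkY z Az s t setT B s0 t0 (@past_setT _ _ _ _ _ _ _) mB.
  rewrite setTI => ->; rewrite K_A//; last exact: measurable_kernel.
  rewrite (@integral_law _ _ _ _ _ (mu z) (Y z s) (K s z))//.
  - exact: mY.
  - by move=> C mC; rewrite law.
  - exact: measurable_kernel.
- move=> t f z t0 [mf _] Az; rewrite /Rintegral K_A//; last exact/measurable_EFinP.
  rewrite (@integral_law _ _ _ _ _ (mu z) (Y z t) (K t z))//.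
  - exact: mY.
  - by move=> C mC; rewrite law.
  - exact/measurable_EFinP.
Qed.

(** * Reversible Markov processes *)

Section cylinders.
Context d (S : measurableType d) (R : realType).
Local Open Scope ereal_scope.
Implicit Type l : seq (R * set S).

(** Finite-dimensional events are described by lists of waiting times, each
    with the set to be visited after it.  Using increments instead of
    absolute times makes the Markov property a recursion on the list, and
    reads the same way forwards and backwards in time. *)
Fixpoint follows l (f : R -> S) : Prop :=
  if l is (r, B) :: l' then B (f r) /\ follows l' (fun u => f (r + u)%R) else True.

Fixpoint schedule l : Prop :=
  if l is (r, B) :: l' then [/\ (0 <= r)%R, measurable B & schedule l'] else True.

Fixpoint duration l : R := if l is (r, _) :: l' then r + duration l' else 0.

Lemma eq_follows l f g : f =1 g -> follows l f = follows l g.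
Proof. by move=> /funext ->. Qed.

Lemma duration_ge0 l : schedule l -> (0 <= duration l)%R.
Proof. by elim: l => //= -[r B] l IHl [r0 _ /IHl]; exact: addr_ge0. Qed.

Lemma measurable_follows d' (T : measurableType d') (Y : R -> T -> S) l :
  (forall u, (0 <= u)%R -> measurable_fun setT (Y u)) -> schedule l ->
  measurable [set w | follows l (Y ^~ w)].
Proof.
elim: l Y => [|[r B] l IHl] Y mY /=.
  by move=> _; rewrite (_ : mkset _ = setT).
move=> [r0 mB sl]; apply: measurableI.
  by rewrite -[X in measurable X]setTI; exact: mY.
by apply: (IHl (fun u => Y (r + u)%R)) => // u u0; apply: mY; exact: addr_ge0.
Qed.

Variable K : R -> R.-pker S ~> S.

(** The probability that a Markov process with transition kernels [K]
    follows [l]. *)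
Fixpoint follow_prob l : S -> \bar R :=
  if l is (r, B) :: l' then
    fun x => \int[K r x]_y ((\1_B y)%:E * follow_prob l' y)
  else fun=> 1.

Lemma follow_prob_ge0 l x : 0 <= follow_prob l x.
Proof.
elim: l x => [|[r B] l IHl] x //=; apply: integral_ge0 => y _.
by rewrite mule_ge0.
Qed.

Lemma measurable_follow_prob l : schedule l -> measurable_fun setT (follow_prob l).
Proof.
elim: l => [|[r B] l IHl] //= [r0 mB sl].
apply: measurable_fun_integral_kernel.
- exact: measurable_kernel.
- by move=> y; rewrite mule_ge0// follow_prob_ge0.
- apply: emeasurable_funM; last exact: IHl.
  by apply/measurable_EFinP; exact: measurable_indic.
Qed.

(** The event [A] plays the part of the past: the first visit of the schedule
    is absorbed into it, and the induction goes on from the time [s + r]. *)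
Lemma markov_process_follows d' (T : measurableType d')
    (mu : {measure set T -> \bar R}) (Y : R -> T -> S) :
  (forall u, (0 <= u)%R -> measurable_fun setT (Y u)) ->
  markov_process mu Y K ->
  forall l s A, schedule l -> (0 <= s)%R -> past Y s A ->
  mu (A `&` [set w | follows l (fun u => Y (s + u)%R w)]) =
  \int[mu]_(w in A) follow_prob l (Y s w).
Proof.
move=> mY mkY; elim => [|[r B] l IHl] s A /= sl s0 YA.
  have mA : measurable A by exact: past_measurable YA.
  by rewrite (_ : mkset _ = setT)// setIT integral_cst// mul1e.
move: sl => [r0 mB sl].
have mfB : measurable_fun setT (fun z => (\1_B z)%:E * follow_prob l z).
  apply: emeasurable_funM; last exact: measurable_follow_prob.
  by apply/measurable_EFinP; exact: measurable_indic.
rewrite -(@markov_process_integral _ _ _ _ _ mu Y K mY mkY s r A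
  (fun z => (\1_B z)%:E * follow_prob l z))//; last first.
  by move=> z; rewrite mule_ge0// follow_prob_ge0.
have YAB : past Y (s + r)%R (A `&` Y (s + r)%R @^-1` B).
  apply: past_setI.
    by apply: past_homo YA; rewrite lerDl.
  by apply: past_preimage => //; rewrite addr_ge0//=.
have := IHl (s + r)%R _ sl (addr_ge0 s0 r0) YAB.
rewrite (_ : _ `&` _ `&` _ = A `&` [set w | B (Y (s + r)%R w) /\
    follows l (fun u => Y (s + (r + u))%R w)]); last first.
  rewrite -setIA; congr (_ `&` _); apply/seteqP; split => w /= [Bw lw]; split => //.
    by rewrite (@eq_follows _ _ (fun u => Y (s + r + u)%R w))// => u; rewrite addrA.
  by rewrite (@eq_follows _ _ (fun u => Y (s + (r + u))%R w))// => u; rewrite addrA.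
move=> ->; rewrite integral_mkcondr; apply: eq_integral => w _.
by rewrite restrict_indic.
Qed.

End cylinders.

Section reversibility.
Context d d' (S : measurableType d) (T : measurableType d') (R : realType).
Local Open Scope ereal_scope.
Implicit Type l : seq (R * set S).
Variables (m : {measure set S -> \bar R}) (P : R.-pker S ~> T).
Variables (Y : R -> T -> S) (K : R -> R.-pker S ~> S).

(** Self-adjointness of the operators of [K] on L^2(m), on nonnegative
    functions. *)
Definition reversible := forall r (f g : S -> \bar R), (0 <= r)%R ->
  (forall x, 0 <= f x) -> measurable_fun setT f ->
  (forall x, 0 <= g x) -> measurable_fun setT g ->
  \int[m]_x (f x * \int[K r x]_y g y) = \int[m]_x (g x * \int[K r x]_y f y).

Hypothesis mY : forall u, (0 <= u)%R -> measurable_fun setT (Y u).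
Hypothesis PY : forall x, markov_process (P x) Y K.
Hypothesis Y0 : forall x, exists2 D, measurable D /\ P x D = 1 &
  forall w, D w -> Y 0 w = x.
Hypothesis revK : reversible.

(** Started from [m] and seen from the time [s], the process has a past [back],
    read backwards, and a future [l].  Self-adjointness moves the observation
    from [s] to the previous visit, which takes one item from [back] and adds
    one to [l]; the integral on the right keeps its value.  Once [back] is
    exhausted, this is the Markov property at time 0.  The integral on the
    right is symmetric in [back] and [l], whence the time reversal. *)
Lemma two_sided_follows back l s B : schedule back -> schedule l ->
  measurable B -> duration back = s ->
  \int[m]_x P x [set w | B (Y s w) /\ follows back (fun u => Y (s - u)%R w) /\
                        follows l (fun u => Y (s + u)%R w)] =
  \int[m]_x (follow_prob K back x * ((\1_B x)%:E * follow_prob K l x)).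
Proof.
elim: back l s B => [|[r C] back IH] l s B /= sb sl mB <-.
  apply: eq_integral => x _; rewrite mul1e.
  have [D [mD PD] DY] := Y0 x.
  have := markov_process_follows mY (PY x) sl (lexx 0%R)
    (@past_preimage _ _ _ _ _ Y 0%R 0%R B _ mB).
  rewrite lexx => /(_ isT); rewrite (_ : _ `&` _ = [set w | B (Y 0%R w) /\ True /\
    follows l (fun u => Y (0 + u)%R w)]); last first.
    by apply/seteqP; split => w /= => [[]//|[? []]].
  move=> ->; rewrite integral_mkcond.
  have mfl := measurable_follow_prob K sl.
  rewrite (@eq_integral_full _ _ _ _ D _
    (fun=> (\1_B x)%:E * follow_prob K l x))//.
  - by rewrite integral_cst// prob_kernel mule1.
  - exact: prob_kernel.
  - have mYB : measurable (Y 0%R @^-1` B).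
      by rewrite -[X in measurable X]setTI; exact: mY.
    apply/(measurable_restrictT _ mYB); apply: measurable_funTS.
    exact: (measurableT_comp mfl (mY (lexx 0%R))).
  - by move=> w Dw; rewrite restrict_indic -(DY w Dw).
move: sb => [r0 mC sb].
have := IH ((r, B) :: l) (duration back) C sb _ mC erefl.
move=> /(_ (And3 r0 mB sl)) /=.
have m1 (E : set S) : measurable E -> measurable_fun setT (fun y => (\1_E y)%:E).
  by move=> mE; apply/measurable_EFinP; exact: measurable_indic.
have revE := @revK r (fun x => (\1_C x)%:E * follow_prob K back x)
  (fun x => (\1_B x)%:E * follow_prob K l x) r0.
have mf E k : measurable E -> schedule k ->
    measurable_fun setT (fun y => (\1_E y)%:E * follow_prob K k y).
  by move=> mE sk; apply: emeasurable_funM; [exact: m1|exact: measurable_follow_prob].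
have f0 (E : set S) k y : 0 <= (\1_E y)%:E * follow_prob K k y.
  by rewrite mule_ge0// follow_prob_ge0.
move: revE => /(_ (f0 C back) (mf C back mC sb) (f0 B l) (mf B l mB sl)) revE.
move=> IHE.
transitivity (\int[m]_x (((\1_B x)%:E * follow_prob K l x) *
    \int[K r x]_y ((\1_C y)%:E * follow_prob K back y))); last first.
  by apply: eq_integral => x _; rewrite muleC.
rewrite -[RHS]revE.
transitivity (\int[m]_x (follow_prob K back x * ((\1_C x)%:E *
    \int[K r x]_y ((\1_B y)%:E * follow_prob K l y)))); last first.
  by apply: eq_integral => x _; rewrite muleA (muleC (follow_prob _ _ _)).
rewrite -IHE; apply: eq_integral => x _; congr (P x _).
set D := duration back.
have ED : (r + D - r = D)%R by rewrite addrAC subrr add0r.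
have Eb w : follows back (fun u => Y (r + D - (r + u))%R w) =
            follows back (fun u => Y (D - u)%R w).
  by apply: eq_follows => u; rewrite opprD addrACA subrr add0r.
have El w : follows l (fun u => Y (r + D + u)%R w) =
            follows l (fun u => Y (D + (r + u))%R w).
  by apply: eq_follows => u; rewrite (addrC r) addrA.
by apply/seteqP; split => w /=; rewrite ED Eb El (addrC D r);
  move=> [? [? ?]]; tauto.
Qed.

(** In [two_sided_follows], [l] is once the whole future and once the whole
    past. *)
Lemma reverse_follows l B : schedule l -> measurable B ->
  \int[m]_x P x [set w | B (Y 0 w) /\ follows l (Y ^~ w)] =
  \int[m]_x P x [set w | B (Y (duration l) w) /\
                         follows l (fun u => Y (duration l - u)%R w)].
Proof.
move=> sl mB.
have := @two_sided_follows [::] l 0%R B I sl mB erefl.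
have := @two_sided_follows l [::] _ B sl I mB erefl => /=.
have -> : \int[m]_x (follow_prob K l x * ((\1_B x)%:E * 1)) =
    \int[m]_x (1 * ((\1_B x)%:E * follow_prob K l x)).
  by apply: eq_integral => x _; rewrite mule1 mul1e muleC.
move=> past_law future_law; transitivity (\int[m]_x P x [set w |
    B (Y 0 w) /\ True /\ follows l (fun u => Y (0 + u)%R w)]).
  apply: eq_integral => x _; congr (P x _).
  have E w : follows l (fun u => Y (0 + u)%R w) = follows l (Y ^~ w).
    by apply: eq_follows => u; rewrite add0r.
  by apply/seteqP; split => w /=; rewrite E; tauto.
rewrite future_law -past_law; apply: eq_integral => x _; congr (P x _).
by apply/seteqP; split => w /=; tauto.
Qed.

End reversibility.

(** * Time reversal of paths *)

Section schedules.
Context d (S : measurableType d) (R : realType).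
Implicit Type l : seq (R * set S).

Lemma follows_local l (f g : R -> S) : schedule l ->
  (forall u, 0 <= u <= duration l -> f u = g u) -> follows l f -> follows l g.
Proof.
elim: l f g => //= -[r B] l IHl f g [r0 mB sl] fg [Bf lf].
have l0 := duration_ge0 sl.
rewrite -fg ?r0 ?lerDl//; split => //; apply: IHl lf => // u /andP[u0 ul].
by apply: fg; rewrite addr_ge0//= lerD2l.
Qed.

(** Cutting a waiting time in two allows a further visit within the duration
    of the schedule. *)
Lemma schedule_insert l (C : set S) u : schedule l -> measurable C ->
  0 <= u <= duration l -> exists l', [/\ schedule l', duration l' = duration l &
    forall f : R -> S, follows l' f <-> C (f u) /\ follows l f].
Proof.
elim: l u => [|[r B] l IHl] u /=.
  move=> _ mC /le_anti <-; exists [:: (0, C)]; split => //=.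
  by rewrite addr0.
move=> [r0 mB sl] mC /andP[u0 ul]; have [ur|ru] := leP u r.
  exists [:: (u, C), (r - u, B) & l]; split => /=.
  - by split => //; split => //; rewrite subr_ge0.
  - by rewrite addrA subrKC.
  - move=> f; rewrite subrKC (_ : (fun v => f (u + (r - u + v))) =
      fun v => f (r + v))//.
    by apply/funext => v; rewrite addrA subrKC.
have := IHl (u - r) sl mC; rewrite subr_ge0 (ltW ru) lerBlDl => /(_ ul).
move=> [k [sk dk fk]]; exists ((r, B) :: k); split => //=; first by rewrite dk.
move=> f; have := fk (fun v => f (r + v)); rewrite subrKC; tauto.
Qed.

Lemma schedule_merge l2 l1 s : schedule l1 -> schedule l2 -> 0 <= s ->
  s + duration l2 <= duration l1 ->
  exists l, [/\ schedule l, duration l = duration l1 &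
    forall f : R -> S,
      follows l f <-> follows l1 f /\ follows l2 (fun u => f (s + u))].
Proof.
elim: l2 l1 s => [|[r C] l2 IH] l1 s /= s1.
  by move=> _ _ _; exists l1; split => // f; tauto.
move=> [r0 mC s2] s0; rewrite addrA => srl.
have sr0 : 0 <= s + r by rewrite addr_ge0.
have l20 := duration_ge0 s2.
have [|l3 [s3 d3 f3]] := @schedule_insert l1 C (s + r) s1 mC.
  by rewrite sr0 (le_trans _ srl)// lerDl.
have [|l4 [s4 d4 f4]] := IH l3 (s + r) s3 s2 sr0; first by rewrite d3.
exists l4; split => //; first by rewrite d4.
move=> f; rewrite f4 f3 (_ : (fun u => f (s + r + u)) =
  fun u => f (s + (r + u))); first tauto.
by apply/funext => u; rewrite addrA.
Qed.

End schedules.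

Section path_reversal.
Context (R : realType) (n : nat) (t : R).
Hypothesis t0 : 0 <= t.
Notation Rn := 'rV[R]_n.
Notation Omega := (cpath n `[0 : R, +oo[).

Lemma measurable_into_paths d (T : measurableType d) (I : set R)
    (F : T -> cpath n I) :
  (forall u, measurable_fun setT (fun w => F w u)) -> measurable_fun setT F.
Proof.
move=> mF; apply: (measurability (@cylinders R n I)) => //.
move=> _ [_ [u [B [mB ->]]] <-].
exact: mF.
Qed.

Lemma measurable_path_eval (I : set R) (u : R) :
  measurable_fun setT (fun w : cpath n I => w u).
Proof.
move=> _ B mB; rewrite setTI; apply: sub_sigma_algebra.
by exists u, B.
Qed.

Lemma path_restrictE (w : Omega) u : 0 <= u <= t -> path_restrict t w u = w u.
Proof. by move=> ut; rewrite /= mem_set//= in_itv. Qed.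

Lemma path_reverseE (w : Omega) u : 0 <= u <= t ->
  path_reverse t w u = w (t - u).
Proof. by move=> ut; rewrite /= mem_set//= in_itv. Qed.

Lemma measurable_path_restrict :
  measurable_fun setT (path_restrict t : Omega -> cpath n `[0, t]).
Proof.
apply: measurable_into_paths => u /=.
by case: (u \in _) => //; exact: measurable_path_eval.
Qed.

Lemma measurable_path_reverse :
  measurable_fun setT (path_reverse t : Omega -> cpath n `[0, t]).
Proof.
apply: measurable_into_paths => u /=.
by case: (u \in _) => //; exact: measurable_path_eval.
Qed.

(** The events about finitely many times of [0, t], written with schedules that
    last exactly [t] so that [reverse_follows] applies.  They form a
    pi-system because schedules can be merged. *)
Definition rectangles : set (set (cpath n `[0, t])) :=
  [set A | exists (B : set Rn) (l : seq (R * set Rn)),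
    [/\ measurable B, schedule l, duration l = t &
        A = [set w : cpath n `[0, t] | B (w 0) /\ follows l w]]].

Lemma rectangles_setI : setI_closed rectangles.
Proof.
move=> _ _ [B1 [l1 [mB1 s1 d1 ->]]] [B2 [l2 [mB2 s2 d2 ->]]].
have [|l [sl dl fl]] := schedule_merge s1 s2 (lexx 0); first by rewrite add0r d1 d2.
exists (B1 `&` B2), l; split => //; [exact: measurableI|by rewrite dl|].
have E (w : cpath n `[0, t]) : follows l2 (fun u => w (0 + u)) = follows l2 w.
  by apply: eq_follows => u; rewrite add0r.
by apply/seteqP; split => w /=; have := fl w; rewrite E; tauto.
Qed.

Lemma rectangles_measurable : rectangles `<=` measurable.
Proof.
move=> _ [B [l [mB sl _ ->]]]; apply: measurableI.
  by rewrite -[X in measurable X]setTI; exact: measurable_path_eval.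
apply: (@measurable_follows _ _ _ _ _ (fun u (w : cpath n `[0, t]) => w u)) => //.
by move=> u _; exact: measurable_path_eval.
Qed.

Lemma rectangle_start (B : set Rn) : measurable B ->
  rectangles [set w : cpath n `[0, t] | B (w 0)].
Proof.
move=> mB; exists B, [:: (t, setT)]; split => //=; first by rewrite addr0.
by apply/seteqP; split => w /=; tauto.
Qed.

Lemma rectangles_generate : @measurable _ (cpath n `[0, t]) = <<s rectangles >>.
Proof.
apply/seteqP; split; last first.
  apply: smallest_sub; first exact: sigma_algebra_measurable.
  exact: rectangles_measurable.
apply: smallest_sub; first exact: smallest_sigma_algebra.
move=> _ [u [B [mB ->]]]; have [ut|ut] := boolP (0 <= u <= t).
  apply: sub_sigma_algebra.
  have [|||l [sl dl fl]] := @schedule_insert _ _ _ [:: (t, setT)] B u.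
  - by split.
  - by [].
  - by rewrite /= addr0.
  exists setT, l; split => //; first by rewrite dl /= addr0.
  by apply/seteqP; split => w /=; have := fl w => /=; tauto.
(* Outside of the interval a path vanishes, so that the cylinder is trivial. *)
have w0 (w : cpath n `[0, t]) : w u = 0.
  case: w => w /= /set_mem[_]; apply => /=; rewrite in_itv/=; exact/negP.
have [B0|B0] := pselect (B 0).
  have -> : [set w : cpath n `[0, t] | B (w u)] = setT.
    by apply/seteqP; split => w //= _; rewrite w0.
  apply: sub_sigma_algebra; exact: (@rectangle_start setT).
have -> : [set w : cpath n `[0, t] | B (w u)] = set0.
  by apply/seteqP; split => w //=; rewrite w0.
exact: sigma_algebra0.
Qed.

Variables (m : {measure set Rn -> \bar R}) (P : R.-pker Rn ~> Omega).
Variable K : R -> R.-pker Rn ~> Rn.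
Hypothesis m_sigma_finite : sigma_finite setT m.
Hypothesis P_start : started_at P.
Hypothesis P_markov : forall x, markov_process (P x) X K.
Hypothesis revK : reversible m K.

Lemma measurable_X u : measurable_fun setT (X u : Omega -> Rn).
Proof. exact: measurable_path_eval. Qed.

Lemma measurable_start x : measurable [set w : Omega | X 0 w = x].
Proof.
rewrite -[X in measurable X]setTI.
exact: (measurable_X 0 measurableT (measurable_rV_set1 x)).
Qed.

(** Started from [m], the paths on [0, t] are distributed as their reversals.
    The two sigma-finite measures on paths agree on [rectangles], hence
    everywhere; the paths that start in a set of finite [m]-measure have
    finite measure. *)
Lemma reverse_path_law A : measurable A ->
  (\int[m]_x P x (path_restrict t @^-1` A) =
   \int[m]_x P x (path_reverse t @^-1` A))%E.
Proof.
pose Pm := mixture m (@measurable_kernel _ _ _ _ _ P).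
pose fwd := image_measure Pm measurable_path_restrict.
pose bwd := image_measure Pm measurable_path_reverse.
have [F coverF finF] := m_sigma_finite.
move: A; apply: (@measure_unique _ _ _ rectangles
  (fun k => [set w : cpath n `[0, t] | F k (w 0)]) _ _ _ _ fwd bwd).
- exact: rectangles_generate.
- exact: rectangles_setI.
- by move=> k; apply: rectangle_start; case: (finF k).
- apply/seteqP; split => // -[w pw] _; have : setT (w 0) by [].
  by rewrite coverF => -[k _ Fk]; exists k.
- move=> _ [B [l [mB sl dl ->]]].
  have start x : exists2 D, measurable D /\ P x D = 1%E &
      forall w, D w -> X 0 w = x.
    by exists [set w | X 0 w = x] => //; split; [exact: measurable_start|exact: P_start].
  have := reverse_follows (fun u _ => measurable_X u) P_markov start revK sl mB.
  rewrite dl => rev.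
  transitivity (\int[m]_x P x [set w | B (X 0 w) /\ follows l (X ^~ w)])%E.
    apply: eq_integral => x _; congr (P x _).
    have fE w : follows l (path_restrict t w) <-> follows l (X ^~ w).
      by split; apply: follows_local => // u; rewrite dl => ut;
        rewrite path_restrictE.
    have t00 : 0 <= (0 : R) <= t by rewrite lexx.
    by apply/seteqP; split => w /=; have := fE w; have := path_restrictE w t00;
      rewrite /X /= => ->; tauto.
  rewrite rev; apply: eq_integral => x _; congr (P x _).
  have fE w : follows l (path_reverse t w) <-> follows l (fun u => X (t - u) w).
    by split; apply: follows_local => // u; rewrite dl => ut;
      rewrite path_reverseE.
  have t00 : 0 <= (0 : R) <= t by rewrite lexx.
  by apply/seteqP; split => w /=; have := fE w; have := path_reverseE w t00;
    rewrite /X /= subr0 => ->; tauto.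
- move=> k; have [mF Fk] := finF k.
  suff -> : fwd [set w : cpath n `[0, t] | F k (w 0)] = m (F k) by [].
  have -> : m (F k) = (\int[m]_x (\1_(F k) x)%:E)%E.
    by rewrite integral_indic// setIT.
  apply: eq_integral => x _; rewrite -diracE.
  rewrite -(@law_constant _ _ _ _ _ (P x) (X 0) x [set w | X 0 w = x])//.
  + have t00 : 0 <= (0 : R) <= t by rewrite lexx.
    have E (w : Omega) : path_restrict t w 0 = w 0 := path_restrictE w t00.
    by congr (P x _); apply/seteqP; split => w; have := E w;
      rewrite /preimage/= => ->.
  + exact: prob_kernel.
  + exact: measurable_start.
  + exact: measurable_X.
Qed.

Lemma integral_reverse_path (f : cpath n `[0, t] -> \bar R) :
  (forall w, 0 <= f w)%E -> measurable_fun setT f ->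
  (\int[m]_x \int[P x]_w f (path_restrict t w) =
   \int[m]_x \int[P x]_w f (path_reverse t w))%E.
Proof.
move=> f0 mf.
pose Pm := mixture m (@measurable_kernel _ _ _ _ _ P).
pose fwd := image_measure Pm measurable_path_restrict.
pose bwd := image_measure Pm measurable_path_reverse.
have mix (g : cpath n `[0 : R, +oo[ -> \bar R) : (forall w, 0 <= g w)%E ->
    measurable_fun setT g ->
    (\int[Pm]_w g w = \int[m]_x \int[P x]_w g w)%E.
  by move=> g0 mg; apply: integral_mixture => //; exact: measurable_kernel.
rewrite -mix//; last exact: measurableT_comp measurable_path_restrict.
rewrite -mix//; last exact: measurableT_comp measurable_path_reverse.
rewrite -(@integral_law _ _ _ _ _ Pm _ fwd)//; last exact: measurable_path_restrict.
rewrite -(@integral_law _ _ _ _ _ Pm _ bwd)//; last exact: measurable_path_reverse.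
by apply: eq_measure_integral => A mA _; exact: reverse_path_law.
Qed.

End path_reversal.

(** * Symmetric transition densities *)

Section diffusion_reversibility.
Context (R : realType) (n : nat).
Notation Rn := 'rV[R]_n.
Notation Omega := (cpath n `[0 : R, +oo[).
Local Open Scope ereal_scope.
Variables (P : R.-pker Rn ~> Omega) (K : R -> R.-pker Rn ~> Rn).
Hypothesis P_start : started_at P.
Hypothesis P_markov : forall x, markov_process (P x) X K.

Lemma transition_law r x B : (0 <= r)%R -> measurable B ->
  K r x B = P x (X r @^-1` B).
Proof.
move=> r0 mB; apply/esym.
apply: (@markov_process_law _ _ _ _ _ (P x) X K _ _ x [set w | X 0 w = x]) => //.
- by move=> u _; exact: measurable_X.
- exact: prob_kernel.
- exact: measurable_start.
Qed.

Lemma transition0 x f : (forall y, 0 <= f y) -> measurable_fun setT f ->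
  \int[K 0%R x]_y f y = f x.
Proof.
move=> f0 mf; rewrite (@eq_measure_integral _ _ _ _ \d_x).
  by rewrite integral_dirac// diracT mul1e.
move=> B mB _; rewrite transition_law//.
apply: (@law_constant _ _ _ _ _ (P x) (X 0%R) x [set w | X 0 w = x]) => //.
- exact: prob_kernel.
- exact: measurable_start.
- exact: measurable_X.
Qed.

Variables (p : R -> Rn -> Rn -> R) (nu : Rn -> R).
Hypothesis nu0 : forall x, (0 <= nu x)%R.
Hypothesis mnu : measurable_fun setT nu.
Hypothesis p_density : transition_density P p.
Hypothesis p_symmetric : forall t x y, (0 < t)%R ->
  (nu x * p t x y = nu y * p t y x)%R.

(** Both sides are the double integral of [nu x * p r x y * f x * g y]; the
    symmetry of [nu x * p r x y] lets Tonelli's theorem exchange [f] and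
    [g].  At time 0 the kernel is a Dirac mass and has no density. *)
Lemma reversible_density : reversible (density_measure nu0 mnu (lebesgue_rV R n)) K.
Proof.
move=> r f g r0 f0 mf g0 mg.
have mT h : (forall y, 0 <= h y) -> measurable_fun setT h ->
    measurable_fun setT (fun x => \int[K r x]_y h y).
  by move=> h0 mh; apply: measurable_fun_integral_kernel => //; exact: measurable_kernel.
have T0 h x : (forall y, 0 <= h y) -> 0 <= \int[K r x]_y h y.
  by move=> h0; exact: integral_ge0.
have dE h k : (forall y, 0 <= h y) -> measurable_fun setT h ->
    (forall y, 0 <= k y) -> measurable_fun setT k ->
    \int[density_measure nu0 mnu (lebesgue_rV R n)]_x (h x * \int[K r x]_y k y) =
    \int[lebesgue_rV R n]_x ((nu x)%:E * (h x * \int[K r x]_y k y)).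
  move=> h0 mh k0 mk; apply: integral_density_measure.
  by apply: emeasurable_funM => //; exact: mT.
rewrite !dE//.
move: r0; rewrite le_eqVlt => /predU1P[<-|r0].
  by apply: eq_integral => x _; rewrite !transition0// (muleC (f x)).
have [mp p0 Pp] := p_density r0.
have TE h x : (forall y, 0 <= h y) -> measurable_fun setT h ->
    \int[K r x]_y h y = \int[lebesgue_rV R n]_y ((p r x y)%:E * h y).
  move=> h0 mh; apply: (@integral_density _ _ _ (p r x)) => //.
  - exact: (measurable_fun_pair2 x mp).
  - by move=> U mU; rewrite transition_law// ?(ltW r0)// Pp.
pose F (z : Rn * Rn) := (nu z.1 * p r z.1 z.2)%:E * (f z.1 * g z.2).
have F0 z : 0 <= F z by rewrite /F mule_ge0 ?mule_ge0// lee_fin mulr_ge0 ?p0.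
have mF : measurable_fun setT F.
  apply: emeasurable_funM.
    apply/measurable_EFinP; apply: measurable_funM => //.
    exact: measurableT_comp mnu measurable_fst.
  apply: emeasurable_funM.
    exact: measurableT_comp mf measurable_fst.
  exact: measurableT_comp mg measurable_snd.
transitivity (\int[lebesgue_rV R n]_x \int[lebesgue_rV R n]_y F (x, y)).
  apply: eq_integral => x _; rewrite TE// muleA -ge0_integralZl//.
  - by apply: eq_integral => y _; rewrite /F/= EFinM muleACA.
  - apply: emeasurable_funM => //.
    by apply/measurable_EFinP; exact: (measurable_fun_pair2 x mp).
  - by move=> y _; rewrite mule_ge0// lee_fin.
  - by rewrite mule_ge0// lee_fin.
rewrite sigma_finite_tonelli//; [|exact: lebesgue_rV_sigma_finite..].
apply: eq_integral => y _; rewrite TE// muleA -ge0_integralZl//.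
- by apply: eq_integral => x _; rewrite /F/= p_symmetric// (muleC (f x)) EFinM muleACA.
- apply: emeasurable_funM => //.
  by apply/measurable_EFinP; exact: (measurable_fun_pair2 y mp).
- by move=> x _; rewrite mule_ge0// lee_fin.
- by rewrite mule_ge0// lee_fin.
Qed.

End diffusion_reversibility.

(** * Transforms of a semigroup by an invariant function *)

Section invariant_transform.
Context d (S : measurableType d) (R : realType).
Variables (h : S -> R) (h0 : forall x, 0 <= h x).
Hypothesis mh : measurable_fun setT h.

Definition weighted_kernel (k : R.-pker S ~> S) (x : S) :
  {measure set S -> \bar R} := density_measure h0 mh (k x).

Let measurable_weighted_kernel k U : measurable U ->
  measurable_fun setT (weighted_kernel k ^~ U).
Proof.
move=> mU; apply: measurable_fun_integral_kernel => //.
- exact: measurable_kernel.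
- exact: measurable_scaled_dirac.
Qed.

HB.instance Definition _ k := isKernel.Build _ _ _ _ R (weighted_kernel k)
  (@measurable_weighted_kernel k).

(** Doob's transform of [k] by [h].  At a point where the weighted kernel has
    mass 0 or infinity it is the Dirac mass at [x0], which makes it a
    probability kernel on the whole space. *)
Definition transformed_kernel (x0 : S) (k : R.-pker S ~> S) : R.-pker S ~> S :=
  knormalize (weighted_kernel k) (\d_x0 : probability S R).

Lemma transformed_kernelE x0 (k : R.-pker S ~> S) x U : 0 < h x ->
  (\int[k x]_y (h y)%:E = (h x)%:E)%E -> measurable U ->
  transformed_kernel x0 k x U = (\int[k x]_(y in U) (h y / h x)%:E)%E.
Proof.
move=> hx inv mU.
have massE : weighted_kernel k x setT = (h x)%:E.
  by rewrite /weighted_kernel density_measureE.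
rewrite [LHS]/= /mnormalize massE /= eqe gt_eqF//=.
rewrite [weighted_kernel k x U]density_measureE -ge0_integralZr//.
- by apply/measurable_EFinP; exact: measurable_funTS.
- by move=> y _; rewrite lee_fin.
- by rewrite lee_fin invr_ge0 ltW.
Qed.

(** The transform of [Q t] at [x] has the density [h y / h x] with respect to
    [Q t x].  Invariance of [h] gives it total mass 1.  The transform does not
    charge the zeros of [h], and [Q] does not lead from them to points where [h] is
    positive, which is what Chapman-Kolmogorov needs. *)
Lemma transformed_semigroup (x0 : S) (Q : R -> R.-pker S ~> S) :
  transition_semigroup setT Q ->
  (forall t x, 0 <= t -> (\int[Q t x]_y (h y)%:E = (h x)%:E)%E) ->
  markov_semigroup [set x | 0 < h x]
    (fun t f x => (h x)^-1 * (\int[Q t x]_y (h y * f y))%R).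
Proof.
move=> [Q1 Q0 QD] inv; set A := [set x | 0 < h x].
have mA : measurable A.
  have -> : A = h @^-1` `]0, +oo[%classic.
    by apply/seteqP; split => x /=; rewrite in_itv/= andbT.
  by rewrite -[X in measurable X]setTI; exact: mh.
have hA y : ~ A y -> h y = 0.
  by move/negP; rewrite -leNgt => hy; apply/le_anti; rewrite hy h0.
pose q x y := h y / h x.
have q0 x y : 0 <= q x y by rewrite divr_ge0.
have mq x : measurable_fun setT (q x).
  by apply: measurable_funM => //; exact: measurable_cst.
pose K t := transformed_kernel x0 (Q t).
have KE t x U : 0 <= t -> A x -> measurable U ->
    (K t x U = \int[Q t x]_(y in U) (q x y)%:E)%E.
  by move=> t0 Ax mU; apply: transformed_kernelE => //; exact: inv.
have intK t x (f : S -> \bar R) : 0 <= t -> A x -> measurable_fun setT f ->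
    (\int[K t x]_y f y = \int[Q t x]_y ((q x y)%:E * f y))%E.
  by move=> t0 Ax mf; apply: integral_density => // U mU; exact: KE.
have qT t x : 0 <= t -> A x -> (\int[Q t x]_y (q x y)%:E = 1)%E.
  move=> t0 Ax; under eq_integral do rewrite /q mulrC EFinM.
  rewrite ge0_integralZl//.
  - by rewrite inv// -EFinM mulVf// gt_eqF.
  - exact/measurable_EFinP.
  - by move=> y _; rewrite lee_fin.
  - by rewrite lee_fin invr_ge0 ltW.
have qA t x (f : S -> \bar R) : (\int[Q t x]_(y in A) ((q x y)%:E * f y) =
    \int[Q t x]_y ((q x y)%:E * f y))%E.
  rewrite integral_mkcond; apply: eq_integral => y _; rewrite patchE.
  case: ifPn => //; rewrite notin_setE => /hA hy.
  by rewrite /q hy mul0r mul0e.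
have intKA t x (f : S -> \bar R) : 0 <= t -> A x -> measurable_fun setT f ->
    (\int[K t x]_(y in A) f y = \int[Q t x]_y ((q x y)%:E * f y))%E.
  move=> t0 Ax mf; rewrite integral_mkcond intK//; last first.
    by apply/(measurable_restrictT _ mA); exact: measurable_funTS.
  rewrite -(qA t x (f \_ A)) -(qA t x f).
  apply: eq_integral => y yA.
  by rewrite patchE yA.
exists K; first split.
- move=> t x t0 Ax; rewrite KE// -(qT t x t0 Ax).
  have := qA t x (fun=> 1%E); under eq_integral do rewrite mule1.
  by move=> ->; under eq_integral do rewrite mule1.
- move=> x B Ax mB; rewrite KE// integral_mkcond.
  rewrite (@eq_measure_integral _ _ _ _ \d_x); last first.
    by move=> C mC _; exact: Q0.
  rewrite integral_dirac//; last first.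
    apply/(measurable_restrictT _ mB); apply: measurable_funTS.
    exact/measurable_EFinP.
  by rewrite diracT mul1e restrict_indic /q mulfV ?gt_eqF// mule1 diracE indicE.
- move=> s t x B s0 t0 Ax mB.
  have mqB y : measurable_fun setT (fun z => ((\1_B z)%:E * (q y z)%:E)%E).
    by apply: emeasurable_funM; apply/measurable_EFinP => //; exact: measurable_indic.
  have qB0 y z : (0 <= (\1_B z)%:E * (q y z)%:E)%E by rewrite mule_ge0// lee_fin.
  have KB t' y : 0 <= t' -> A y ->
      (K t' y B = \int[Q t' y]_z ((\1_B z)%:E * (q y z)%:E))%E.
    move=> t'0 Ay; rewrite KE// integral_mkcond; apply: eq_integral => z _.
    by rewrite restrict_indic.
  rewrite KB ?addr_ge0// intKA//; last exact: measurable_kernel.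
  rewrite (@integral_mixture _ _ _ _ _ (Q s x) (Q t))//; last 2 first.
    by move=> U mU; exact: measurable_kernel.
    by move=> U mU; rewrite QD.
  rewrite -[RHS]qA [RHS]integral_mkcond; apply: eq_integral => y _; rewrite patchE.
  case: ifPn => [/set_mem Ay|].
    rewrite KB// -ge0_integralZl//.
    - apply: eq_integral => z _; rewrite muleCA -!EFinM; congr (_ * _)%:E.
      by rewrite /q [RHS]mulrC -mulrA mulKf// gt_eqF.
    - by rewrite lee_fin.
  rewrite notin_setE => /hA hy.
  apply/eqP; rewrite eq_le; apply/andP; split; last exact: integral_ge0.
  apply: (@le_trans _ _ (\int[Q t y]_z ((h x)^-1%:E * (h z)%:E))%E).
    apply: ge0_le_integral => //.
    - by apply: emeasurable_funM => //; exact/measurable_EFinP.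
    - move=> z _; rewrite -!EFinM lee_fin.
      by rewrite [leRHS]mulrC -[leRHS]/(q x z) mulrC ler_piMr ?q0.
  rewrite ge0_integralZl ?inv ?hy ?mule0//.
  - exact/measurable_EFinP.
  - by move=> z _; rewrite lee_fin.
  - by rewrite lee_fin invr_ge0.
- move=> t f x t0 [mf [M fM]] Ax.
  have mhE : measurable_fun setT (EFin \o h) by exact/measurable_EFinP.
  rewrite -RintegralZl//; last first.
    have -> : EFin \o (fun y => h y * f y) = ((EFin \o f) \* (EFin \o h))%E.
      by apply/funext => y /=; rewrite mulrC EFinM.
    apply: integrableMr => //.
      exists M; split; first exact: num_real.
      by move=> N MN y _; rewrite /= (le_trans (fM y))// ltW.
    apply/integrableP; split => //.
    under eq_integral do rewrite /= ger0_norm//.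
    by rewrite inv// ltry.
  rewrite /Rintegral intKA//; last exact/measurable_EFinP.
  by congr fine; apply: eq_integral => y _; rewrite -EFinM /q mulrA (mulrC (h y)).
Qed.

End invariant_transform.

(** * Duality between the flow and its time reversal *)

Section duality.
Context (R : realType) (n : nat) (Dbar : ptopologicalType).
Notation Rn := 'rV[R]_n.
Notation Omega := (cpath n `[0 : R, +oo[).
Variables (Dstar : set Dbar) (Psi : forall t : R, borel Dbar * cpath n `[0, t] -> borel Dbar).
Variables (P : R.-pker Rn ~> Omega) (K : R -> R.-pker Rn ~> Rn).
Variables (m : {measure set Rn -> \bar R}) (Q : R -> R.-pker borel Dbar ~> borel Dbar).
Variable Gamma : borel Dbar * Rn -> R.
Hypothesis Psi_ds : dynamical_system Dstar Psi.
Hypothesis P_start : started_at P.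
Hypothesis P_markov : forall x, markov_process (P x) X K.
Hypothesis m_sigma_finite : sigma_finite setT m.
Hypothesis revK : reversible m K.
Hypothesis Q_semigroup : transition_semigroup setT Q.
Hypothesis Q_flow : forall t (f : borel Dbar -> R) xs x, 0 < t -> bounded_measurable f ->
  (\int[Q t xs]_ys f ys)%R =
  (\int[P x]_w f (Psi (xs, path_reverse t w)))%R.
Hypothesis mGamma : measurable_fun setT Gamma.
Hypothesis Gamma0 : forall z, 0 <= Gamma z.
Hypothesis Gamma_boundary : forall xs x, ~ Dstar xs -> Gamma (xs, x) = 0.
Hypothesis Gamma_invariant : forall (xs : Dbar) (w : Omega) t, 0 < t ->
  Gamma (xs, X 0 w) = Gamma (Psi (xs, path_restrict t w), X t w).

Lemma measurable_flow t xs (F : Omega -> cpath n `[0, t]) : 0 <= t ->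
  measurable_fun setT F -> measurable_fun setT (fun w => Psi (xs, F w)).
Proof.
move=> t0 mF; apply: (measurableT_comp (Psi_ds.1 t t0)).
by apply/measurable_fun_pairP; split => //=; exact: measurable_cst.
Qed.

Lemma measurable_joint xs t : 0 <= t ->
  measurable_fun setT (joint_process Psi xs t).
Proof.
move=> t0; apply/measurable_fun_pairP; split.
  by apply: measurable_flow => //; exact: measurable_path_restrict.
exact: measurable_X.
Qed.

Lemma joint_process0 xs w : Dstar xs -> joint_process Psi xs 0 w = (xs, X 0 w).
Proof. by move=> Dxs; rewrite /joint_process (Psi_ds.2 xs w Dxs).1. Qed.

Lemma Q_law t xs x (B : set (borel Dbar)) : 0 < t -> measurable B ->
  (Q t xs B = P x ((fun w => Psi (xs, path_reverse t w)) @^-1` B))%E.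
Proof.
move=> t0 mB; have mF : measurable_fun setT (fun w => Psi (xs, path_reverse t w)).
  by apply: measurable_flow; [exact: ltW|exact: measurable_path_reverse].
have mFB : measurable ((fun w => Psi (xs, path_reverse t w)) @^-1` B).
  by rewrite -[X in measurable X]setTI; exact: mF.
have bB : bounded_measurable (\1_B : borel Dbar -> R).
  split; first exact: measurable_indic.
  by exists 1 => z; rewrite indicE; case: (_ \in _); rewrite ?normr1 ?normr0.
rewrite -(fineK (finite_kernel_measure (Q t) xs mB)).
rewrite -(fineK (finite_kernel_measure P x mFB)); congr EFin.
have := Q_flow xs x t0 bB; rewrite /Rintegral integral_indic// setIT => ->.
congr fine.
transitivity (\int[P x]_w
    (\1_((fun w => Psi (xs, path_reverse t w)) @^-1` B) w)%:E)%E => //.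
by rewrite integral_indic// setIT.
Qed.

Local Open Scope ereal_scope.

(** By time reversal, the pair of the flow driven by [X] and of [X t] is traded
    for the pair of the flow driven by the reversed path and of the starting
    point [x].  The law of that flow does not depend on [x], so that the
    two integrations separate. *)
Lemma mixed_flow_reversal t xs (f : borel Dbar * Rn -> \bar R) : (0 < t)%R ->
  (forall z, 0 <= f z) -> measurable_fun setT f ->
  \int[m]_x \int[P x]_w f (joint_process Psi xs t w) =
  \int[Q t xs]_ys \int[m]_x f (ys, x).
Proof.
move=> t0 f0 mf; have t0' := ltW t0.
pose F (v : cpath n `[0%R, t]) := f (Psi (xs, v), v t).
have mF : measurable_fun setT F.
  apply: (measurableT_comp mf); apply/measurable_fun_pairP; split => /=.
    exact: (measurableT_comp (Psi_ds.1 t t0') (pair1_measurable _)).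
  exact: measurable_path_eval.
have tt : (0 <= t <= t)%R by rewrite t0' lexx.
transitivity (\int[m]_x \int[P x]_w F (path_restrict t w)).
  apply: eq_integral => x _; apply: eq_integral => w _.
  by rewrite /F path_restrictE.
rewrite (integral_reverse_path t0' m_sigma_finite P_start P_markov revK)//; last first.
  by move=> v; exact: f0.
have mV : measurable_fun setT (fun w => Psi (xs, path_reverse t w)).
  by apply: measurable_flow => //; exact: measurable_path_reverse.
transitivity (\int[m]_x \int[Q t xs]_ys f (ys, x)).
  apply: eq_integral => x _.
  have mfx : measurable_fun setT (fun ys => f (ys, x)) by exact: measurable_fun_pair1.
  rewrite (@integral_law _ _ _ _ _ (P x) (fun w => Psi (xs, path_reverse t w)) (Q t xs))//.
    apply: (@eq_integral_full _ _ _ (P x) [set w | X 0 w = x]).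
    - exact: prob_kernel.
    - exact: measurable_start.
    - exact: P_start.
    - exact: (measurableT_comp mF (@measurable_path_reverse R n t)).
    - exact: (measurableT_comp mfx mV).
    - by move=> w X0; rewrite /F path_reverseE// subrr (_ : path_val w 0%R = x).
  by move=> B mB; exact: Q_law.
rewrite (@sigma_finite_tonelli _ _ _ _ _ m (Q t xs) (fun z => f (z.2, z.1)))//.
- apply: fin_num_fun_sigma_finite; first by rewrite measure0.
  exact: finite_kernel_measure.
- by apply: (measurableT_comp mf); exact: measurable_swap.
Qed.

(** The heart of the matter: [Gamma] is constant along the joint process, so
    that on the left it can be evaluated at time [t], inside the expectation,
    and the time reversal applies to [Gamma * g]. *)
Lemma flow_duality t xs (g : borel Dbar * Rn -> \bar R) : (0 <= t)%R ->
  (forall z, 0 <= g z) -> measurable_fun setT g ->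
  \int[m]_x ((Gamma (xs, x))%:E * \int[P x]_w g (joint_process Psi xs t w)) =
  \int[Q t xs]_ys \int[m]_x ((Gamma (ys, x))%:E * g (ys, x)).
Proof.
move=> t0 g0 mg.
pose f z := (Gamma z)%:E * g z.
have f0 z : 0 <= f z by rewrite mule_ge0// lee_fin.
have mf : measurable_fun setT f.
  by apply: emeasurable_funM => //; exact/measurable_EFinP.
have mgJ := measurableT_comp mg (measurable_joint xs t0).
have start x (h k : Omega -> \bar R) : measurable_fun setT h ->
    measurable_fun setT k -> (forall w, X 0 w = x -> h w = k w) ->
    \int[P x]_w h w = \int[P x]_w k w.
  move=> mh mk hk; apply: (@eq_integral_full _ _ _ (P x) [set w | X 0 w = x]) => //.
  - exact: prob_kernel.
  - exact: measurable_start.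
move: t0; rewrite le_eqVlt => /predU1P[t0|t0].
  rewrite -t0; have [_ Q0 _] := Q_semigroup.
  rewrite [RHS](@eq_measure_integral _ _ _ _ \d_xs); last first.
    by move=> B mB _; exact: Q0.
  rewrite integral_dirac//; last first.
    apply: (@measurable_section_integral _ _ _ _ _ m f) => //.
  rewrite diracT mul1e; apply: eq_integral => x _.
  have [Dxs|nDxs] := pselect (Dstar xs); last by rewrite Gamma_boundary// !mul0e.
  rewrite (@start x _ (fun=> g (xs, x))).
  - by rewrite integral_cst// prob_kernel mule1.
  - by rewrite -t0 in mgJ.
  - exact: measurable_cst.
  - by move=> w X0; rewrite joint_process0// X0.
rewrite -(mixed_flow_reversal xs t0 f0 mf); apply: eq_integral => x _.
rewrite -ge0_integralZl//; last by rewrite lee_fin.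
apply: start => [||w X0].
- by apply: emeasurable_funM => //; exact: measurable_cst.
- by apply: (measurableT_comp mf); apply: measurable_joint; exact: ltW.
- by rewrite /f -[x in LHS]X0 (Gamma_invariant xs w t0).
Qed.

End duality.

(** * The link *)

Section link.
Context (R : realType) (n : nat) (Dbar : ptopologicalType).
Notation Rn := 'rV[R]_n.
Variables (Gamma : borel Dbar * Rn -> R) (nu : Rn -> R).
Hypothesis Gamma0 : forall z, 0 <= Gamma z.
Hypothesis mGamma : measurable_fun setT Gamma.
Hypothesis nu0 : forall x, 0 <= nu x.
Hypothesis mnu : measurable_fun setT nu.
Hypothesis finite_mass : forall xs,
  (\int[lebesgue_rV R n]_x (Gamma (xs, x) * nu x)%:E < +oo)%E.

Definition weighted_lebesgue : {measure set Rn -> \bar R} :=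
  density_measure nu0 mnu (lebesgue_rV R n).

Lemma weighted_lebesgue_sigma_finite : sigma_finite setT weighted_lebesgue.
Proof.
have mnuk k : measurable [set x | nu x <= k%:R].
  rewrite (_ : mkset _ = nu @^-1` `]-oo, k%:R]%classic).
    by rewrite -[X in measurable X]setTI; exact: mnu.
  by apply/seteqP; split => x /=; rewrite in_itv.
pose F k : set Rn := cube k `&` [set x | nu x <= k%:R].
exists F.
  apply/seteqP; split => // x _; have : setT x by [].
  rewrite -(cube_cover R n) => -[k _ xk].
  exists (maxn k (Num.bound (nu x))) => //; split => [i|/=].
    by apply: (le_trans (xk i)); rewrite ler_nat leq_maxl.
  apply: (@le_trans _ _ (Num.bound (nu x))%:R).
    by apply: ltW; exact: archi_boundP.
  by rewrite ler_nat leq_maxr.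
move=> k; have mck : measurable (@cube R n k) by exact: measurable_cube.
have mF : measurable (F k) by exact: measurableI.
split => //; rewrite [ltLHS]density_measureE.
apply: (@le_lt_trans _ _ (\int[lebesgue_rV R n]_(x in F k) k%:R%:E)%E).
  apply: ge0_le_integral => //.
  - by move=> x _; rewrite lee_fin.
  - by apply/measurable_EFinP; exact: measurable_funTS.
  - by move=> x [_ xk]; rewrite lee_fin.
rewrite integral_cst//; apply: lte_mul_pinfty => //.
apply: le_lt_trans (lebesgue_cube_fin R n k).
by apply: le_measure; rewrite ?inE//; exact: subIsetl.
Qed.

Lemma integral_weighted_lebesgue (f : Rn -> \bar R) : measurable_fun setT f ->
  (\int[weighted_lebesgue]_x f x = \int[lebesgue_rV R n]_x ((nu x)%:E * f x))%E.
Proof. exact: integral_density_measure. Qed.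

Lemma measurable_Gamma_section ys : measurable_fun setT (fun x => Gamma (ys, x)).
Proof. exact: measurable_fun_pair2. Qed.

Lemma total_massE ys :
  (total_mass Gamma nu ys)%:E = (\int[weighted_lebesgue]_x (Gamma (ys, x))%:E)%E.
Proof.
rewrite integral_weighted_lebesgue; last first.
  by apply/measurable_EFinP; exact: measurable_Gamma_section.
rewrite /total_mass /Rintegral fineK.
  by apply: eq_integral => x _; rewrite -EFinM mulrC.
rewrite ge0_fin_numE//; apply: integral_ge0 => x _.
by rewrite lee_fin mulr_ge0.
Qed.

Lemma total_mass_ge0 ys : 0 <= total_mass Gamma nu ys.
Proof. by apply: Rintegral_ge0 => x _; rewrite mulr_ge0. Qed.

Lemma measurable_total_mass : measurable_fun setT (total_mass Gamma nu).
Proof.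
apply/measurable_EFinP; rewrite (_ : EFin \o _ =
  fun ys => (\int[weighted_lebesgue]_x (Gamma (ys, x))%:E)%E); last first.
  by apply/funext => ys; rewrite -total_massE.
apply: (@measurable_section_integral _ _ _ _ _ _ (EFin \o Gamma)).
- exact: weighted_lebesgue_sigma_finite.
- by move=> z; rewrite lee_fin.
- exact/measurable_EFinP.
Qed.

(** The integral against the link, before division by the total mass; unlike
    the link, it is well behaved where the total mass vanishes. *)
Definition Gamma_integral (G : Rn -> R) (ys : borel Dbar) : \bar R :=
  (\int[weighted_lebesgue]_x ((Gamma (ys, x))%:E * (G x)%:E))%E.

Section bounded_integrand.
Variables (G : Rn -> R) (M : R).
Hypothesis mG : measurable_fun setT G.
Hypothesis G0 : forall x, 0 <= G x.
Hypothesis GM : forall x, G x <= M.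

Let GE x : (0 <= (G x)%:E)%E. Proof. by rewrite lee_fin. Qed.

Let mGammaE ys : measurable_fun setT (fun x => (Gamma (ys, x))%:E).
Proof. by apply/measurable_EFinP; exact: measurable_Gamma_section. Qed.

Let mGE : measurable_fun setT (fun x => (G x)%:E).
Proof. exact/measurable_EFinP. Qed.

Lemma Gamma_integral_ge0 ys : (0 <= Gamma_integral G ys)%E.
Proof. by apply: integral_ge0 => x _; rewrite mule_ge0// lee_fin. Qed.

Lemma Gamma_integral_le ys :
  (Gamma_integral G ys <= M%:E * (total_mass Gamma nu ys)%:E)%E.
Proof.
have M0 : 0 <= M by exact: le_trans (G0 0) (GM 0).
rewrite total_massE -ge0_integralZl//.
- apply: ge0_le_integral => //.
  + by move=> x _; rewrite mule_ge0// lee_fin.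
  + exact: emeasurable_funM.
  + by apply: emeasurable_funM => //; exact: measurable_cst.
  + by move=> x _; rewrite muleC -!EFinM lee_fin ler_wpM2r.
- by move=> x _; rewrite lee_fin.
Qed.

Lemma Gamma_integral_fin ys : Gamma_integral G ys \is a fin_num.
Proof.
rewrite ge0_fin_numE ?Gamma_integral_ge0//.
by rewrite (le_lt_trans (Gamma_integral_le ys))// -EFinM ltry.
Qed.

Lemma link_integralE ys :
  (\int[lebesgue_rV R n]_x (link Gamma nu ys x * G x)%:E =
   (total_mass Gamma nu ys)^-1%:E * Gamma_integral G ys)%E.
Proof.
have h0 := total_mass_ge0 ys.
rewrite /Gamma_integral integral_weighted_lebesgue; last exact: emeasurable_funM.
rewrite -ge0_integralZl//.
- apply: eq_integral => x _; rewrite -!EFinM /link; congr EFin.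
  by rewrite [_ / _]mulrC -!mulrA [nu x * (_ * _)]mulrCA.
- by apply: emeasurable_funM; [exact/measurable_EFinP|exact: emeasurable_funM].
- by move=> x _; rewrite !mule_ge0// lee_fin.
- by rewrite lee_fin invr_ge0.
Qed.

Lemma link_integrable ys : (lebesgue_rV R n).-integrable setT
  (EFin \o (fun x => link Gamma nu ys x * G x)).
Proof.
apply/integrableP; split.
  apply/measurable_EFinP; apply: measurable_funM => //.
  apply: measurable_funM => //; apply: measurable_funM; last exact: measurable_cst.
  exact: measurable_Gamma_section.
under eq_integral.
  move=> x _; rewrite /= ger0_norm; first over.
  by rewrite mulr_ge0// /link mulr_ge0// mulr_ge0// invr_ge0 total_mass_ge0.
by rewrite link_integralE -(fineK (Gamma_integral_fin ys)) -EFinM ltry.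
Qed.

Lemma link_RintegralE ys :
  (\int[lebesgue_rV R n]_x (link Gamma nu ys x * G x))%R =
  (total_mass Gamma nu ys)^-1 * fine (Gamma_integral G ys).
Proof.
rewrite /Rintegral link_integralE.
by rewrite -{1}(fineK (Gamma_integral_fin ys)) -EFinM.
Qed.

Lemma total_mass_link ys :
  total_mass Gamma nu ys *
    (\int[lebesgue_rV R n]_x (link Gamma nu ys x * G x))%R =
  fine (Gamma_integral G ys).
Proof.
(* Where the total mass is 0, so is the integral, by [Gamma_integral_le]. *)
rewrite link_RintegralE; have [h0|h0] := eqVneq (total_mass Gamma nu ys) 0.
  rewrite h0 mul0r; apply/esym.
  suff -> : Gamma_integral G ys = 0%E by [].
  apply/eqP; rewrite eq_le Gamma_integral_ge0 andbT.
  by apply: (le_trans (Gamma_integral_le ys)); rewrite h0 mule0.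
by rewrite mulrA mulfV// mul1r.
Qed.

End bounded_integrand.

End link.

(** * The intertwining relation *)

Section intertwining.
Context (R : realType) (n : nat) (Dbar : ptopologicalType).
Notation Rn := 'rV[R]_n.
Notation Omega := (cpath n `[0 : R, +oo[).
Notation T := (borel Dbar * Rn)%type.
Variables (Gamma : T -> R) (nu : Rn -> R).
Hypothesis Gamma0 : forall z, 0 <= Gamma z.
Hypothesis mGamma : measurable_fun setT Gamma.
Hypothesis nu0 : forall x, 0 <= nu x.
Hypothesis mnu : measurable_fun setT nu.
Hypothesis finite_mass : forall xs,
  (\int[lebesgue_rV R n]_x (Gamma (xs, x) * nu x)%:E < +oo)%E.
Variables (Psi : forall t : R, borel Dbar * cpath n `[0, t] -> borel Dbar).
Variables (P : R.-pker Rn ~> Omega) (Q : R -> R.-pker borel Dbar ~> borel Dbar).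
Hypothesis mJ : forall xs t, 0 <= t -> measurable_fun setT (joint_process Psi xs t).
Notation m := (weighted_lebesgue nu0 mnu).
Notation h := (total_mass Gamma nu).
Hypothesis duality : forall t xs (g : T -> \bar R), 0 <= t ->
  (forall z, (0 <= g z)%E) -> measurable_fun setT g ->
  (\int[m]_x ((Gamma (xs, x))%:E * \int[P x]_w g (joint_process Psi xs t w)) =
   \int[Q t xs]_ys \int[m]_x ((Gamma (ys, x))%:E * g (ys, x)))%E.

(** The duality for the constant function 1. *)
Lemma total_mass_invariant t xs : 0 <= t ->
  (\int[Q t xs]_ys (h ys)%:E = (h xs)%:E)%E.
Proof.
move=> t0.
have P1 x : (\int[P x]_w 1 = 1)%E by rewrite integral_cst// prob_kernel mule1.
have /= := @duality t xs (fun=> 1%E) t0 (fun _ => lee01) (@measurable_cst _ _ _ _ _ _).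
under eq_integral do rewrite P1 mule1.
rewrite -total_massE// => ->; apply: eq_integral => ys _.
by rewrite total_massE//; under [RHS]eq_integral do rewrite mule1.
Qed.

Section nonnegative.
Variables (t : R) (xs : borel Dbar) (g : T -> R) (M : R).
Hypothesis t0 : 0 <= t.
Hypothesis mg : measurable_fun setT g.
Hypothesis g0 : forall z, 0 <= g z.
Hypothesis gM : forall z, g z <= M.

Let gE0 z : (0 <= (g z)%:E)%E. Proof. by rewrite lee_fin. Qed.

Let mgE : measurable_fun setT (EFin \o g). Proof. exact/measurable_EFinP. Qed.

Let mgJ : measurable_fun setT (fun w => (g (joint_process Psi xs t w))%:E).
Proof. exact: (measurableT_comp mgE (mJ xs t0)). Qed.

Let VM x : (\int[P x]_w (g (joint_process Psi xs t w))%:E <= M%:E)%E.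
Proof.
apply: (@le_trans _ _ (\int[P x]_w (M%:E))%E).
  apply: ge0_le_integral => //.
  by move=> w _; rewrite lee_fin.
by rewrite integral_cst// prob_kernel mule1.
Qed.

Lemma coupled_semigroupE x : (coupled_semigroup Psi P t g (xs, x))%:E =
  (\int[P x]_w (g (joint_process Psi xs t w))%:E)%E.
Proof.
rewrite /coupled_semigroup /Rintegral fineK// ge0_fin_numE; last exact: integral_ge0.
exact: le_lt_trans (VM x) (ltry _).
Qed.

Lemma coupled_semigroup_ge0 x : 0 <= coupled_semigroup Psi P t g (xs, x).
Proof. exact: Rintegral_ge0. Qed.

Lemma coupled_semigroup_le x : coupled_semigroup Psi P t g (xs, x) <= M.
Proof. by rewrite -lee_fin coupled_semigroupE. Qed.

Lemma bounded_coupled_integrable x :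
  (P x).-integrable setT (EFin \o (fun w => g (joint_process Psi xs t w))).
Proof.
apply/integrableP; split; first exact: mgJ.
under eq_integral do rewrite /= ger0_norm//.
exact: le_lt_trans (VM x) (ltry _).
Qed.

Lemma measurable_coupled_semigroup :
  measurable_fun setT (fun x => coupled_semigroup Psi P t g (xs, x)).
Proof.
apply/measurable_EFinP; rewrite (_ : EFin \o _ = fun x =>
  (\int[P x]_w (g (joint_process Psi xs t w))%:E)%E); last first.
  by apply/funext => x; rewrite -coupled_semigroupE.
apply: measurable_fun_integral_kernel => //.
exact: measurable_kernel.
Qed.

Let mgs ys : measurable_fun setT (fun x => g (ys, x)).
Proof. exact: measurable_fun_pair2. Qed.

Lemma weighted_linkE ys :
  h ys * (\int[lebesgue_rV R n]_y (link Gamma nu ys y * g (ys, y)))%R =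
  fine (Gamma_integral Gamma nu0 mnu (fun y => g (ys, y)) ys).
Proof. by apply: (@total_mass_link _ _ _ _ _ _ _ _ _ _ _ M). Qed.

Let dualityE : (\int[Q t xs]_ys
    (h ys * (\int[lebesgue_rV R n]_y (link Gamma nu ys y * g (ys, y)))%R)%:E =
  Gamma_integral Gamma nu0 mnu
    (fun x => coupled_semigroup Psi P t g (xs, x)) xs)%E.
Proof.
rewrite /Gamma_integral; under [RHS]eq_integral do rewrite coupled_semigroupE.
rewrite (@duality t xs (EFin \o g))//; apply: eq_integral => ys _.
rewrite weighted_linkE fineK//; exact: (@Gamma_integral_fin _ _ _ _ _ _ _ _ _ _ _ M).
Qed.

(** By duality, the integral is bounded by [M] times the total mass at [xs]. *)
Lemma weighted_link_integrable : (Q t xs).-integrable setT (EFin \o (fun ys =>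
  h ys * (\int[lebesgue_rV R n]_y (link Gamma nu ys y * g (ys, y)))%R)).
Proof.
apply/integrableP; split.
  under eq_fun do rewrite weighted_linkE.
  apply/measurable_EFinP; apply: measurableT_comp => //.
  apply: (@measurable_section_integral _ _ _ _ _ m
    (fun z => (Gamma z)%:E * (g z)%:E)%E).
  - exact: weighted_lebesgue_sigma_finite.
  - by move=> z; rewrite mule_ge0// lee_fin.
  - by apply: emeasurable_funM => //; exact/measurable_EFinP.
under eq_integral.
  move=> ys _; rewrite /= ger0_norm; first over.
  rewrite weighted_linkE fine_ge0//; exact: Gamma_integral_ge0.
rewrite dualityE ltey_eq (@Gamma_integral_fin _ _ _ _ _ _ _ _ _ _ _ M)//.
- exact: measurable_coupled_semigroup.
- exact: coupled_semigroup_ge0.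
- exact: coupled_semigroup_le.
Qed.

Lemma link_coupled_integrable : (lebesgue_rV R n).-integrable setT
  (EFin \o (fun x => link Gamma nu xs x * coupled_semigroup Psi P t g (xs, x))).
Proof.
apply: (@link_integrable _ _ _ _ _ _ _ _ _ _ _ M) => //.
- exact: measurable_coupled_semigroup.
- exact: coupled_semigroup_ge0.
- exact: coupled_semigroup_le.
Qed.

Lemma link_intertwines_ge0 :
  (\int[lebesgue_rV R n]_x (link Gamma nu xs x * coupled_semigroup Psi P t g (xs, x)))%R =
  conjugate_semigroup Gamma nu Q t (fun ys =>
    (\int[lebesgue_rV R n]_y (link Gamma nu ys y * g (ys, y)))%R) xs.
Proof.
rewrite (@link_RintegralE _ _ _ _ _ _ _ _ _ _ _ M)//; first last.
- exact: coupled_semigroup_le.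
- exact: coupled_semigroup_ge0.
- exact: measurable_coupled_semigroup.
by rewrite /conjugate_semigroup /Rintegral dualityE.
Qed.

End nonnegative.

(** The duality concerns nonnegative functions.  A function bounded by [M] is
    the difference of the nonnegative functions [g + M] and [M], and both
    sides are additive on such functions, all integrals being finite. *)
Lemma link_intertwines t xs g : 0 <= t -> bounded_measurable g ->
  (\int[lebesgue_rV R n]_x (link Gamma nu xs x * coupled_semigroup Psi P t g (xs, x)))%R =
  conjugate_semigroup Gamma nu Q t (fun ys =>
    (\int[lebesgue_rV R n]_y (link Gamma nu ys y * g (ys, y)))%R) xs.
Proof.
move=> t0 [mg [M gM]].
have M0 : 0 <= M by exact: le_trans (gM point).
pose g1 z := g z + M; pose g2 (z : T) := M.
have gE z : g z = g1 z - g2 z by rewrite /g1 /g2 addrK.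
have mg1 : measurable_fun setT g1 by apply: measurable_funD => //; exact: measurable_cst.
have mg2 : measurable_fun setT g2 by exact: measurable_cst.
have g10 z : 0 <= g1 z.
  by rewrite -lerBlDr sub0r; have := gM z; rewrite ler_norml => /andP[].
have g1M z : g1 z <= M + M.
  by rewrite lerD2r; have := gM z; rewrite ler_norml => /andP[].
have g2M z : g2 z <= M by [].
have g20 z : 0 <= g2 z by [].
have VE x : coupled_semigroup Psi P t g (xs, x) =
    coupled_semigroup Psi P t g1 (xs, x) - coupled_semigroup Psi P t g2 (xs, x).
  rewrite /coupled_semigroup -RintegralB//=.
  - by apply: eq_Rintegral => w _; exact: gE.
  - exact: (@bounded_coupled_integrable _ _ g1 (M + M)).
  - exact: (@bounded_coupled_integrable _ _ g2 M).
have LE ys : (\int[lebesgue_rV R n]_y (link Gamma nu ys y * g (ys, y)))%R =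
    (\int[lebesgue_rV R n]_y (link Gamma nu ys y * g1 (ys, y)))%R -
    (\int[lebesgue_rV R n]_y (link Gamma nu ys y * g2 (ys, y)))%R.
  rewrite -RintegralB//.
  - by apply: eq_Rintegral => y _; rewrite -mulrBr -gE.
  - by apply: (@link_integrable _ _ _ _ _ _ _ _ _ _ _ (M + M)) => //;
      exact: measurable_fun_pair2.
  - by apply: (@link_integrable _ _ _ _ _ _ _ _ _ _ _ M) => //;
      exact: measurable_fun_pair2.
under eq_Rintegral do rewrite VE mulrBr.
rewrite RintegralB//; last 2 first.
  exact: (@link_coupled_integrable _ _ _ (M + M)).
  exact: (@link_coupled_integrable _ _ _ M).
rewrite (@link_intertwines_ge0 _ _ g1 (M + M))// (@link_intertwines_ge0 _ _ g2 M)//.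
rewrite /conjugate_semigroup -mulrBr -RintegralB//.
- by congr (_ * _); apply: eq_Rintegral => ys _; rewrite -mulrBr -LE.
- exact: (@weighted_link_integrable _ _ _ (M + M)).
- exact: (@weighted_link_integrable _ _ _ M).
Qed.

End intertwining.

(** * Linked semigroups *)

Theorem proposition3p5 (R : realType) (n : nat)
  (gamma : 'rV[R]_n -> R)
  (gamma_diff : forall x, differentiable gamma x)
  (gamma_C1 : continuous (gradient gamma))
  (P : R.-pker 'rV[R]_n ~> cpath n `[0 : R, +oo[)
  (P_diffusion : diffusion (gradient gamma) P)
  (p : R -> 'rV[R]_n -> 'rV[R]_n -> R)
  (p_density : transition_density P p)
  (p_symmetric : forall t x y, 0 < t ->
    stationary_density gamma x * p t x y = stationary_density gamma y * p t y x)
  (Dbar : ptopologicalType) (Dstar : set Dbar)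
  (Dbar_polish : polish R [set: Dbar])
  (Dstar_open : open Dstar) (Dstar_polish : polish R Dstar)
  (Gamma : borel Dbar * 'rV[R]_n -> R)
  (Gamma_meas : measurable_fun ((Dstar : set (borel Dbar)) `*` setT) Gamma)
  (Gamma_ge0 : forall xs x, Dstar xs -> 0 <= Gamma (xs, x))
  (Gamma_bounded : exists M : R, forall xs x, Dstar xs -> Gamma (xs, x) <= M)
  (Gamma_boundary : forall xs x, ~ Dstar xs -> Gamma (xs, x) = 0)
  (E_polish : polish R (state_space Dstar Gamma))
  (h_finite_pos : forall xs, Dstar xs ->
    (0 < \int[lebesgue_rV R n]_x (Gamma (xs, x) * stationary_density gamma x)%:E < +oo)%E)
  (Psi : forall t : R, borel Dbar * cpath n `[0, t] -> borel Dbar)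
  (Psi_ds : dynamical_system Dstar Psi)
  (hyp_a : forall (xs : Dbar) (w : cpath n `[0, +oo[) t, 0 < t ->
    Gamma (xs, X 0 w) = Gamma (Psi t (xs, path_restrict t w), X t w))
  (Q : R -> R.-pker borel Dbar ~> borel Dbar)
  (hyp_b_semigroup : transition_semigroup setT Q)
  (hyp_b : forall t (f : borel Dbar -> R) xs x, 0 < t -> bounded_measurable f ->
    (\int[Q t xs]_ys f ys)%R =
    (\int[P x]_w f (Psi t (xs, path_reverse t w)))%R)
  (hyp_c : preserves_markov Dstar Psi) :
  Lambda_linked Dstar (state_space Dstar Gamma)
    (coupled_semigroup Psi P)
    (diffusion_semigroup P)
    (conjugate_semigroup Gamma (stationary_density gamma) Q)
    (link Gamma (stationary_density gamma)).
Proof.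
have [P_start [K P_markov] _] := P_diffusion.
set nu := stationary_density gamma.
have nu0 x : 0 <= nu x by exact: expR_ge0.
have mnu : measurable_fun setT nu.
  apply: measurableT_comp => //; apply: measurable_funM; first exact: measurable_cst.
  by apply: continuous_measurable_rV => x; exact: differentiable_continuous.
have mDstar : measurable (Dstar : set (borel Dbar)) by exact: sub_sigma_algebra.
have Gamma0 z : 0 <= Gamma z.
  case: z => xs x; have [/Gamma_ge0 //|/Gamma_boundary ->//] := pselect (Dstar xs).
have mGamma : measurable_fun setT Gamma.
  have -> : Gamma = Gamma \_ ((Dstar : set (borel Dbar)) `*` setT).
    apply/funext => -[xs x]; rewrite patchE; case: ifPn => //.
    by rewrite notin_setE => nD; apply: Gamma_boundary => Dxs; exact: nD.
  by apply/(measurable_restrictT _ (measurableX mDstar measurableT)).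
have finite_mass xs : (\int[lebesgue_rV R n]_x (Gamma (xs, x) * nu x)%:E < +oo)%E.
  have [/h_finite_pos/andP[]//|nD] := pselect (Dstar xs).
  by under eq_integral do rewrite Gamma_boundary// mul0r; rewrite integral0 ltry.
have mJ := measurable_joint Psi_ds.
have msf := @weighted_lebesgue_sigma_finite R n nu nu0 mnu.
have revK := reversible_density P_start P_markov nu0 mnu p_density p_symmetric.
have duality := flow_duality Psi_ds P_start P_markov msf revK hyp_b_semigroup
  hyp_b mGamma Gamma0 Gamma_boundary hyp_a.
have E_pos z : state_space Dstar Gamma z <-> 0 < Gamma z.
  split => [[]//|Gz]; split => //; apply: contrapT => nD.
  by move: Gz; case: z nD => xs x /= /Gamma_boundary ->; rewrite ltxx.
have mE : measurable (state_space Dstar Gamma : set (borel Dbar * 'rV[R]_n)).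
  rewrite (_ : state_space _ _ = Gamma @^-1` `]0, +oo[%classic); last first.
    by apply/seteqP; split => z /=; rewrite in_itv/= andbT => /E_pos.
  by rewrite -[X in measurable X]setTI; exact: mGamma.
(* The joint process stays in E: Gamma is constant and positive along it, and
   it vanishes on the boundary. *)
have E_joint (xs : borel Dbar) x w t : 0 <= t -> state_space Dstar Gamma (xs, x) ->
    X 0 w = x -> state_space Dstar Gamma (joint_process Psi xs t w).
  rewrite le_eqVlt => /predU1P[<-|t0] Ez X0w.
    by rewrite (joint_process0 Psi_ds) ?X0w//; case: Ez.
  by apply/E_pos; rewrite -[joint_process _ _ _ _]/(_, _) -hyp_a// X0w; exact/E_pos.
have Dstar_pos : Dstar = [set xs | 0 < total_mass Gamma nu xs].
  apply/seteqP; split => xs /=.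
    by move=> /h_finite_pos; exact: fine_gt0.
  apply: contraPP => nD; apply/negP; rewrite -leNgt.
  by rewrite /total_mass; under eq_Rintegral do rewrite Gamma_boundary// mul0r;
    rewrite Rintegral_cst// mul0r.
split.
- apply: (@markov_processes_semigroup _ _ _ _ _ setT P (fun=> X)
    (fun x => [set w | X 0 w = x]) K) => //.
  + by move=> x _; split; [exact: prob_kernel|exact: measurable_start|exact: P_start|].
  + by move=> x t _ _; exact: measurable_X.
- rewrite Dstar_pos.
  apply: (transformed_semigroup _ _ point hyp_b_semigroup).
  + exact: total_mass_ge0.
  + exact: measurable_total_mass.
  + move=> t xs; exact: (@total_mass_invariant _ _ _ _ _ Gamma0 mGamma nu0 mnu
      finite_mass _ _ _ duality).
- have [L P_joint] := hyp_c P P_start (ex_intro _ K P_markov).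
  apply: (@markov_processes_semigroup _ _ _ _ _
    (state_space Dstar Gamma : set (borel Dbar * 'rV[R]_n))
    (fun z => P z.2) (fun z => joint_process Psi z.1)
    (fun z => [set w | X 0 w = z.2]) L) => //.
  + move=> [xs x] Ez; split; [exact: prob_kernel|exact: measurable_start|exact: P_start|].
    move=> w X0w; split; last by move=> t t0; exact: E_joint X0w.
    by rewrite (joint_process0 Psi_ds) ?X0w//; case: Ez.
  + by move=> z t _; exact: mJ.
  + by move=> [xs x] [Dxs _]; exact: P_joint.
- move=> t g f t0 [mg _] [mf _] gf [xs x] Ez.
  rewrite /coupled_semigroup /diffusion_semigroup /Rintegral/=; congr fine.
  apply: (@eq_integral_full _ _ _ (P x) [set w | X 0 w = x]).
  + exact: prob_kernel.
  + exact: measurable_start.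
  + exact: P_start.
  + by apply/measurable_EFinP; apply: (measurableT_comp mg); exact: mJ.
  + by apply/measurable_EFinP; apply: (measurableT_comp mf); exact: measurable_X.
  + by move=> w X0w; rewrite gf//; exact: E_joint X0w.
- move=> t xs g t0 _ bg.
  exact: (@link_intertwines _ _ _ _ _ Gamma0 mGamma nu0 mnu finite_mass Psi P Q mJ duality).
Qed.
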